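(* Let $G$ be a right-angled Artin group or right-angled Coxeter group which is not virtually cyclic and does not split as a (direct) product. Let $S_n$ be the set of elements of $G$ of word length exactly $n$ with respect to the standard vertex generating set. Then there exist $\lambda>1$ and $C>0$ such that $$\lim_{n\to\infty}\frac{\#S_n}{\lambda^n}=C.$$
   Context: For a finite simplicial graph $\Lambda$, the right-angled Artin group $A(\Lambda)$ is generated by the vertices of $\Lambda$, with relations $[v,w]=1$ for each edge $(v,w)$ of $\Lambda$; the right-angled Coxeter group $C(\Lambda)$ is obtained by adding the relations $v^2=1$ for each vertex $v$. The standard (vertex) generating set is $\{v^{\pm1}:v\in V(\Lambda)\}$. *)

(* Defs.v *)
From HB Require Import structures.
From mathcomp Require Import all_boot all_order all_algebra.
From mathcomp Require Import all_classical all_reals all_analysis.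

Set Implicit Arguments.
Unset Strict Implicit.
Unset Printing Implicit Defensive.

Import Order.TTheory GRing.Theory Num.Theory.
Import numFieldNormedType.Exports.

Local Open Scope classical_set_scope.
Local Open Scope group_scope.

(* The letter (v, true) stands for v and (v, false) for v^-1. *)
Definition letter (V : Type) := (V * bool)%type.
Definition word (V : Type) := seq (letter V).

Definition letter_inv (V : Type) (a : letter V) : letter V := (a.1, ~~ a.2).
Definition word_inv (V : Type) (u : word V) : word V :=
  rev (map (@letter_inv V) u).

(* Two words are related iff they represent the same element of < V | rels >,
   where each r in rels is a relator, i.e. is declared equal to 1. *)
Inductive pres_eq (V : Type) (rels : set (word V)) : word V -> word V -> Prop :=
| pres_eq_refl u : pres_eq rels u u
| pres_eq_sym u v : pres_eq rels u v -> pres_eq rels v u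
| pres_eq_trans u v w : pres_eq rels u v -> pres_eq rels v w -> pres_eq rels u w
| pres_eq_cat u u' v v' :
    pres_eq rels u u' -> pres_eq rels v v' -> pres_eq rels (u ++ v) (u' ++ v')
| pres_eq_cancel a : pres_eq rels [:: a; letter_inv a] [::]
| pres_eq_rel r : rels r -> pres_eq rels r [::].

Section PresentedGroup.
Variables (V : choiceType) (rels : set (word V)).
Implicit Types u v w : word V.

Definition pres_eqb : rel (word V) := fun u v => `[< pres_eq rels u v >].

Lemma pres_eqb_refl : reflexive pres_eqb.
Proof. by move=> u; apply/asboolP; exact: pres_eq_refl. Qed.

Lemma pres_eqb_sym : symmetric pres_eqb.
Proof. by move=> u v; apply/asboolP/asboolP; exact: pres_eq_sym. Qed.

Lemma pres_eqb_trans : transitive pres_eqb.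
Proof.
move=> v u w /asboolP uv /asboolP vw; apply/asboolP.
exact: pres_eq_trans uv vw.
Qed.

Canonical pres_equiv := EquivRel pres_eqb
  pres_eqb_refl pres_eqb_sym pres_eqb_trans.

Definition presented := {eq_quot pres_equiv}%qT.

HB.instance Definition _ := Choice.on presented.

Definition pres_class u : presented := (\pi_({eq_quot pres_equiv}) u)%qT.
Definition pres_repr (g : presented) : word V :=
  repr (g : {eq_quot pres_equiv}%qT).

Lemma pres_reprK g : pres_class (pres_repr g) = g.
Proof. exact: reprK. Qed.

Lemma pres_classP u v : pres_class u = pres_class v <-> pres_eq rels u v.
Proof.
split=> [/eqP|uv]; first by rewrite /pres_class eqmodE => /asboolP.
by apply/eqP; rewrite /pres_class eqmodE; apply/asboolP.
Qed.

Lemma pres_repr_class u : pres_eq rels (pres_repr (pres_class u)) u.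
Proof. by apply/pres_classP; rewrite pres_reprK. Qed.

Lemma letter_invK : involutive (@letter_inv V).
Proof. by case=> a b; rewrite /letter_inv /= negbK. Qed.

Lemma word_inv_cat u v : word_inv (u ++ v) = word_inv v ++ word_inv u.
Proof. by rewrite /word_inv map_cat rev_cat. Qed.

Lemma word_invK : involutive (@word_inv V).
Proof.
move=> u; rewrite /word_inv map_rev revK -map_comp -[RHS]map_id.
by apply: eq_map => a; exact: letter_invK.
Qed.

Lemma pres_eq_catV u : pres_eq rels (u ++ word_inv u) [::].
Proof.
elim: u => [|a u IH]; first exact: pres_eq_refl.
rewrite -cat1s word_inv_cat catA -[([:: a] ++ u) ++ _]catA.
apply: pres_eq_trans (pres_eq_cancel rels a).
rewrite -[X in pres_eq _ _ X]/(([:: a] ++ [::]) ++ [:: letter_inv a]).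
apply: pres_eq_cat; last exact: pres_eq_refl.
by apply: pres_eq_cat => //; exact: pres_eq_refl.
Qed.

Lemma pres_eq_Vcat u : pres_eq rels (word_inv u ++ u) [::].
Proof. by have := pres_eq_catV (word_inv u); rewrite word_invK. Qed.

Lemma pres_eq_inv u v :
  pres_eq rels u v -> pres_eq rels (word_inv u) (word_inv v).
Proof.
move=> uv; have vVu : pres_eq rels (v ++ word_inv u) [::].
  apply: pres_eq_trans (pres_eq_catV u).
  by apply: pres_eq_cat; [exact: pres_eq_sym|exact: pres_eq_refl].
apply: (@pres_eq_trans _ _ _ (word_inv v ++ (v ++ word_inv u))).
  rewrite catA -[X in pres_eq _ X _]cat0s.
  apply: pres_eq_cat; last exact: pres_eq_refl.
  by apply: pres_eq_sym; exact: pres_eq_Vcat.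
rewrite -[X in pres_eq _ _ X]cats0.
by apply: pres_eq_cat => //; exact: pres_eq_refl.
Qed.

Definition pres_mul (g h : presented) : presented :=
  pres_class (pres_repr g ++ pres_repr h).
Definition pres_one : presented := pres_class [::].
Definition pres_inv (g : presented) : presented :=
  pres_class (word_inv (pres_repr g)).

Lemma pres_mulE u v :
  pres_mul (pres_class u) (pres_class v) = pres_class (u ++ v).
Proof.
by apply/pres_classP; apply: pres_eq_cat; exact: pres_repr_class.
Qed.

Lemma pres_invE u : pres_inv (pres_class u) = pres_class (word_inv u).
Proof. by apply/pres_classP/pres_eq_inv/pres_repr_class. Qed.

Lemma pres_mulA : associative pres_mul.
Proof.
move=> g h k; rewrite -(pres_reprK g) -(pres_reprK h) -(pres_reprK k).
by rewrite !pres_mulE catA.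
Qed.

Lemma pres_mul1 : left_id pres_one pres_mul.
Proof. by move=> g; rewrite -(pres_reprK g) pres_mulE. Qed.

Lemma pres_mulr1 : right_id pres_one pres_mul.
Proof. by move=> g; rewrite -(pres_reprK g) pres_mulE cats0. Qed.

Lemma pres_mulV : left_inverse pres_one pres_inv pres_mul.
Proof.
move=> g; rewrite -(pres_reprK g) pres_invE pres_mulE.
by apply/pres_classP; exact: pres_eq_Vcat.
Qed.

Lemma pres_mulrV : right_inverse pres_one pres_inv pres_mul.
Proof.
move=> g; rewrite -(pres_reprK g) pres_invE pres_mulE.
by apply/pres_classP; exact: pres_eq_catV.
Qed.

HB.instance Definition _ := isGroup.Build presented
  pres_mulA pres_mul1 pres_mulr1 pres_mulV pres_mulrV.

Definition pres_gen (v : V) : presented := pres_class [:: (v, true)].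

Definition std_gens : set presented :=
  [set g | exists v : V, g = pres_gen v \/ g = (pres_gen v)^-1].

End PresentedGroup.

Arguments std_gens {V} rels _.

Definition comm_word (V : Type) (v w : V) : word V :=
  [:: (v, false); (w, false); (v, true); (w, true)].

Definition raag_relators (V : Type) (e : rel V) : set (word V) :=
  [set r | exists v w, e v w /\ r = comm_word v w].

Definition racg_relators (V : Type) (e : rel V) : set (word V) :=
  raag_relators e `|` [set r | exists v, r = [:: (v, true); (v, true)]].

Definition cyclic_subgroup (G : groupType) (g : G) : set G :=
  [set x | exists n : nat, x = g ^+ n \/ x = g ^- n].

(* The right cosets H t, for t in ts, cover G. *)
Definition finite_index (G : groupType) (H : set G) : Prop :=
  exists ts : seq G, forall x, exists2 t, t \in ts & H (x * t^-1).

Definition virtually_cyclic (G : groupType) : Prop :=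
  exists g : G, finite_index (cyclic_subgroup g).

Definition nontrivial (G : groupType) : Prop := exists g : G, g <> 1.

Definition splits_as_product (G : groupType) : Prop :=
  exists (A B : groupType) (f : {multiplicative G -> (A * B)%type}),
    [/\ nontrivial A, nontrivial B & bijective f].

Definition is_product_of_length (G : groupType) (S : set G) (g : G) (n : nat) :=
  exists s : seq G, [/\ size s = n, {in s, forall x, S x} & g = \prod_(x <- s) x].

Definition has_word_length (G : groupType) (S : set G) (g : G) (n : nat) :=
  is_product_of_length S g n /\
  forall m, is_product_of_length S g m -> (n <= m)%N.

Definition sphere (G : groupType) (S : set G) (n : nat) : set G :=
  [set g | has_word_length S g n].

Lemma finite_sphere (G : groupType) (S : set G) n :
  finite_set S -> finite_set (sphere S n).
Proof.
move=> finS; have /finite_seqP[t St] := finS.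
pose F (w : n.-tuple (seq_sub t)) : G := \prod_(x <- w) ssval x.
apply: (@sub_finite_set _ _ (F @` setT)); last first.
  by apply: finite_image; exact: finite_finset.
move=> g [[s [sn sS ->]] _].
have st x : x \in s -> x \in t by move=> /sS; rewrite St.
have [w Ew] : exists w : seq (seq_sub t), s = map (@ssval _ t) w.
  elim: s {sn sS} st => [|x s IH] st; first by exists [::].
  have [|w ->] := IH; first by move=> y ys; apply: st; rewrite inE ys orbT.
  have xt : x \in t by apply: st; rewrite inE eqxx.
  by exists (SeqSub xt :: w).
have wn : size w == n by rewrite -sn Ew size_map.
by exists (Tuple wn) => //; rewrite /F /= Ew big_map.
Qed.

Lemma finite_std_gens (V : finType) (rels : set (word V)) :
  finite_set (std_gens rels).
Proof.
apply: (@sub_finite_set _ _ ((fun a : V * bool =>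
    if a.2 then pres_gen rels a.1 else (pres_gen rels a.1)^-1) @` setT)).
  by move=> g [v [->|->]]; [exists (v, true)|exists (v, false)].
by apply: finite_image; exact: finite_finset.
Qed.

(* Main.v *)
Require Import Defs.
From HB Require Import structures.
From mathcomp Require Import all_boot all_order all_algebra.
From mathcomp Require Import finmap.
From mathcomp Require Import all_classical all_reals all_analysis.
From mathcomp Require Import ring lra zify.
Import Order.TTheory GRing.Theory Num.Theory.
Import numFieldNormedType.Exports.
Local Open Scope classical_set_scope.
Local Open Scope ring_scope.

Set Implicit Arguments.
Unset Strict Implicit.
Unset Printing Implicit Defensive.

(** Both kinds of groups are described at once by a finite alphabet of letters with a
    formal inverse and a commutation relation: an Artin group has the letters v and
    v^-1 for each vertex, a Coxeter group has one self-inverse letter for each vertex.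
    Every group element has a reduced word, unique up to commutations, and its length
    is the word length ([card_sphere]); so spheres are counted by counting reduced
    words up to commutation.

    The graph of noncommuting vertices is connected, since otherwise the group would be
    a direct product ([noncommuting_connected]).  Some vertex v can be removed without
    disconnecting it ([walk_around_vertex]).  Let s(x) be the growth series of the
    group, w(x) that of the subgroup generated by the other vertices, and t(x) the
    series that counts those elements of this subgroup none of whose possible first
    letters commutes with v.  Peeling off first letters yields

      s(x) (1 - F(x)) = (1 + x) w(x),   F(x) = m x t(x) - x,

    where m is the number of letters of v, hence 1 or 2 ([vertex_renewal]).  The
    coefficients of F are nonnegative, and positive in every degree at least 2, so this
    is a renewal equation.

    Let x0 be the point where F takes the value 1.  The series w converges beyond x0:
    a walk through all vertices other than v, starting next to v, can be prepended to
    any element of the subgroup, and the result is counted by t; therefore w converges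
    wherever t does ([num_avoid_two_walks]), in particular at x0, and as the
    coefficients of w are submultiplicative its set of convergence is open
    ([psum_submul_open]).  So F and w converge at some point larger than x0
    ([critical_radius]), the probability distribution F_n x0^n has a finite mean mu,
    and the renewal theorem ([renewal_theorem]) gives
    s_n x0^n -> (1 + x0) w(x0) / mu.  Thus lambda = 1 / x0.  That lambda > 1 follows
    from F_n >= 1 for n >= 2.  This bound needs two letters a and b, not those of v, for
    which the alternating words a b a b ... are reduced; the exclusion of virtually
    cyclic groups provides them. *)

(** * Traces: words up to commutation *)

Section Traces.
Import mathcomp.boot.fintype mathcomp.boot.finset.
Local Open Scope set_scope.
Local Open Scope nat_scope.

Variables (A : finType) (inv : A -> A) (c : rel A).
Implicit Types (a b d x y : A) (w z : seq A) (U X : {set A}).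

(** Equality of all projections to two noncommuting letters.  This is the congruence
    generated by the commutations, in a form that is decidable and visibly compatible
    with concatenation and cancellation.  Since no letter commutes with itself, [a = b]
    is among the pairs and the number of occurrences of each letter is recorded. *)
Definition trace_eq w z :=
  [forall a, forall b, ~~ c a b ==>
     ([seq x <- w | x \in pred2 a b] == [seq x <- z | x \in pred2 a b])].

Lemma trace_eqP w z :
  reflect (forall a b, ~~ c a b ->
             [seq x <- w | x \in pred2 a b] = [seq x <- z | x \in pred2 a b])
          (trace_eq w z).
Proof.
apply: (iffP forallP) => [wz a b ncab|wz a].
  by have /forallP/(_ b)/implyP/(_ ncab)/eqP := wz a.
by apply/forallP => b; apply/implyP => ncab; apply/eqP/wz.
Qed.

Lemma trace_eq_refl : reflexive trace_eq.
Proof. by move=> w; apply/trace_eqP. Qed.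

Lemma trace_eq_sym : symmetric trace_eq.
Proof.
by move=> w z; apply/trace_eqP/trace_eqP => E a b nc; rewrite E.
Qed.

Lemma trace_eq_trans : transitive trace_eq.
Proof.
by move=> z w y /trace_eqP E /trace_eqP F; apply/trace_eqP => a b nc;
  rewrite E // F.
Qed.

Lemma trace_eq_cat w w' z z' :
  trace_eq w w' -> trace_eq z z' -> trace_eq (w ++ z) (w' ++ z').
Proof.
move=> /trace_eqP E /trace_eqP F; apply/trace_eqP => a b nc.
by rewrite !filter_cat E // F.
Qed.

Lemma trace_eq_catl w z z' : trace_eq (w ++ z) (w ++ z') = trace_eq z z'.
Proof.
apply/idP/idP => [/trace_eqP E|]; last by apply: trace_eq_cat; exact: trace_eq_refl.
apply/trace_eqP => a b /E; rewrite !filter_cat => /eqP.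
by rewrite eqseq_cat // eqxx => /eqP.
Qed.

Lemma trace_eq_cons a w z : trace_eq (a :: w) (a :: z) = trace_eq w z.
Proof. exact: (trace_eq_catl [:: a]). Qed.

Definition trace_nf w := choose (trace_eq w) w.

Lemma trace_nf_eq w : trace_eq w (trace_nf w).
Proof. by apply: chooseP; exact: trace_eq_refl. Qed.

Lemma eq_trace_nf w z : (trace_nf w == trace_nf z) = trace_eq w z.
Proof.
apply/eqP/idP => [E|wz].
  apply: trace_eq_trans (trace_nf_eq w) _; rewrite E trace_eq_sym.
  exact: trace_nf_eq.
rewrite /trace_nf (@choose_id _ _ w z) ?trace_eq_refl //.
apply: eq_choose => y.
by apply/idP/idP; apply: trace_eq_trans; rewrite // trace_eq_sym.
Qed.

Lemma trace_nfK w : trace_nf (trace_nf w) = trace_nf w.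
Proof. by apply/eqP; rewrite eq_trace_nf trace_eq_sym trace_nf_eq. Qed.

Hypothesis c_irr : irreflexive c.

Lemma trace_eq_perm w z : trace_eq w z -> perm_eq w z.
Proof.
move=> /trace_eqP E; apply/allP => a _ /=.
have cnt s : count_mem a s = size [seq x <- s | x \in pred2 a a].
  by rewrite size_filter; apply: eq_count => x; rewrite !inE orbb.
by apply/eqP; rewrite !cnt E // c_irr.
Qed.

Lemma trace_eq_size w z : trace_eq w z -> size w = size z.
Proof. by move/trace_eq_perm/perm_size. Qed.

Lemma size_trace_nf w : size (trace_nf w) = size w.
Proof. by apply/esym/trace_eq_size/trace_nf_eq. Qed.

(** The left descents of a trace: the letters that commutations can bring to the
    front. *)
Fixpoint initial a w :=
  if w is x :: w' then (x == a) || c a x && initial a w' else false.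

(** Being a left descent is visible in the projections, hence depends only on the
    trace. *)
Lemma initialP a w : reflect
  (forall b, ~~ c a b -> ohead [seq x <- w | x \in pred2 a b] = Some a)
  (initial a w).
Proof.
elim: w => [|x w IH] /=; first by constructor => /(_ a); rewrite c_irr => /(_ isT).
case: eqVneq => [->|xa] /=.
  by constructor => b _; rewrite inE eqxx.
case cax: (c a x) => /=.
  have E b : ~~ c a b -> (x \in pred2 a b) = false.
    move=> ncab; rewrite !inE (negPf xa) /=; apply/negbTE.
    by apply: contraNneq ncab => <-.
  by apply: (iffP IH) => H b ncab; have := H b ncab; rewrite E.
constructor => /(_ x); rewrite cax => /(_ isT).
by rewrite !inE eqxx orbT /= => -[] /eqP; rewrite (negPf xa).
Qed.

Lemma initial_trace_eq a w z : trace_eq w z -> initial a w = initial a z.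
Proof.
by move=> /trace_eqP E; apply/initialP/initialP => H b nc; rewrite -(H b nc) E.
Qed.

Hypothesis c_sym : symmetric c.

Lemma swap_trace_eq a b w : c a b -> trace_eq (a :: b :: w) (b :: a :: w).
Proof.
move=> cab; apply/trace_eqP => p q ncpq /=.
case ap: (a \in pred2 p q); case bp: (b \in pred2 p q) => //.
have ab : a != b by apply: contraTneq cab => ->; rewrite c_irr.
case/negP: ncpq; move: ap bp; rewrite !inE.
by case/orP => /eqP ?; case/orP => /eqP ?; subst; move: ab cab;
  rewrite ?eqxx // => _; rewrite // c_sym => ->.
Qed.

Lemma rem_initial a w : initial a w -> trace_eq w (a :: rem a w).
Proof.
elim: w => //= x w IH; case: eqVneq => [->|xa] /=; first by rewrite trace_eq_refl.
case/andP => cax iw; apply: (@trace_eq_trans (x :: a :: rem a w)).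
  by rewrite trace_eq_cons IH.
by apply: swap_trace_eq; rewrite c_sym.
Qed.

Lemma initial_cons a w : initial a (a :: w).
Proof. by rewrite /= eqxx. Qed.

Hypothesis invK : involutive inv.
Hypothesis c_inv : forall a b, c a (inv b) = c a b.

Lemma c_invl a b : c (inv a) b = c a b.
Proof. by rewrite c_sym c_inv c_sym. Qed.

Lemma c_neq a b : c a b -> a != b.
Proof. by apply: contraTneq => ->; rewrite c_irr. Qed.

Lemma c_neq_inv a b : c a b -> a != inv b.
Proof. by move=> cab; apply: c_neq; rewrite c_inv. Qed.

(** Together with the invariance of [initial], this recursive test says that no word of
    the same trace contains a letter next to its inverse. *)
Fixpoint reduced w :=
  if w is x :: w' then ~~ initial (inv x) w' && reduced w' else true.

(** A letter [x] standing before [a] commutes with it, so [a] does not hide an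
    occurrence of [inv x] behind it: a cancellation in [rem a w] would already exist
    in [w]. *)
Lemma reduced_rem a w : reduced w -> initial a w ->
  reduced (rem a w) && ~~ initial (inv a) (rem a w).
Proof.
elim: w => //= x w IH /andP[nix rw]; case: eqVneq => [<-|xa] /=.
  by rewrite rw nix.
case/andP => cax iw; have /andP[rr nia] := IH rw iw.
rewrite rr andbT (negPf nia) andbF orbF.
have -> : (x == inv a) = false by apply/negbTE/c_neq_inv; rewrite c_sym.
rewrite andbT; apply: contra nix => H.
by rewrite (initial_trace_eq _ (rem_initial iw)) /= H c_invl c_sym cax orbT.
Qed.

Lemma reduced_trace_eq w z : trace_eq w z -> reduced w = reduced z.
Proof.
have imp : forall n w z, size z <= n -> trace_eq w z -> reduced w -> reduced z.
  elim=> [|n IH] {}w {}z; first by case: z.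
  case: z => // a z; rewrite ltnS => sz wz rw.
  have iw : initial a w by rewrite (initial_trace_eq _ wz) initial_cons.
  have /andP[rr nia] := reduced_rem rw iw.
  have rz : trace_eq (rem a w) z.
    rewrite -(trace_eq_cons a) trace_eq_sym.
    apply: trace_eq_trans (rem_initial iw).
    by rewrite trace_eq_sym.
  by rewrite /= -(initial_trace_eq _ rz) nia (IH (rem a w)).
move=> wz; apply/idP/idP; first exact: imp (leqnn _) wz.
by rewrite trace_eq_sym in wz; exact: imp (leqnn _) wz.
Qed.

(** * Counting reduced traces *)

Definition nf_words n (P : pred (seq A)) : seq (seq A) :=
  [seq w <- [seq val t | t <- enum {: n.-tuple A}] | P w && (trace_nf w == w)].

Definition num_traces P n := size (nf_words n P).

Lemma mem_nf_words n P w :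
  (w \in nf_words n P) = [&& size w == n, P w & trace_nf w == w].
Proof.
rewrite mem_filter andbC; case: (size w =P n) => [sw|sw].
  congr andb; apply/mapP; exists (Tuple (introT eqP sw)) => //.
  by rewrite mem_enum.
by apply/negbTE; apply: contra_notN sw => /andP[/mapP[t _ ->] _];
  rewrite size_tuple.
Qed.

Lemma nf_words_uniq n P : uniq (nf_words n P).
Proof.
by apply: filter_uniq; rewrite map_inj_uniq ?enum_uniq //; exact: val_inj.
Qed.

Definition trace_invariant (P : pred (seq A)) :=
  forall w z, trace_eq w z -> P w = P z.

(** Traces are counted through representatives, but a map between sets of traces is most
    easily given on words; this transfers an injection up to [trace_eq]. *)
Lemma leq_num_traces (P Q : pred (seq A)) (f : seq A -> seq A) n m :
  trace_invariant Q ->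
  (forall w, size w = n -> P w -> size (f w) = m /\ Q (f w)) ->
  (forall w z, size w = n -> size z = n -> P w -> P z ->
      trace_eq (f w) (f z) -> trace_eq w z) ->
  num_traces P n <= num_traces Q m.
Proof.
move=> Qinv Qf fI; rewrite /num_traces.
rewrite -(size_map (trace_nf \o f)); apply: uniq_leq_size.
  rewrite map_inj_in_uniq ?nf_words_uniq // => w z.
  rewrite !mem_nf_words => /and3P[/eqP sw Pw /eqP Ew] /and3P[/eqP sz Pz /eqP Ez].
  move=> /= /eqP; rewrite eq_trace_nf => /(fI _ _ sw sz Pw Pz).
  by rewrite -eq_trace_nf Ew Ez => /eqP.
move=> y /mapP[w]; rewrite mem_nf_words => /and3P[/eqP sw Pw _] -> /=.
have [sf Qfw] := Qf _ sw Pw.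
by rewrite mem_nf_words size_trace_nf sf eqxx trace_nfK eqxx
  -(Qinv _ _ (trace_nf_eq _)) Qfw.
Qed.

Lemma eq_num_traces P Q n : (forall w, size w = n -> P w = Q w) ->
  num_traces P n = num_traces Q n.
Proof.
move=> PQ; congr size; apply: eq_in_filter => w /mapP[t _ ->].
by rewrite PQ // size_tuple.
Qed.

Lemma num_traces_split P (D : pred (seq A)) n :
  num_traces P n =
  num_traces (fun w => P w && ~~ D w) n + num_traces (fun w => P w && D w) n.
Proof.
rewrite /num_traces /nf_words !size_filter.
elim: [seq val t | t <- _] => //= w s ->.
by rewrite addnACA; congr addn; case: (P w); case: (D w); case: (trace_nf w == w).
Qed.

Lemma num_traces_gt0 P n w : trace_invariant P -> size w = n -> P w ->
  0 < num_traces P n.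
Proof.
move=> Pinv sw Pw; rewrite -has_predT; apply/hasP; exists (trace_nf w) => //.
by rewrite mem_nf_words size_trace_nf sw eqxx trace_nfK eqxx
  -(Pinv _ _ (trace_nf_eq _)) Pw.
Qed.

(** If [X] is contained in [U] and both are closed under inversion, the traces of these
    words are the elements of minimal length in their cosets [G_X g] inside the subgroup
    [G_U] generated by [U]. *)
Definition red_avoid U X w :=
  [&& all (mem U) w, reduced w & [forall x in X, ~~ initial x w]].

Definition num_avoid U X n := num_traces (red_avoid U X) n.

Lemma red_avoid_inv U X : trace_invariant (red_avoid U X).
Proof.
move=> w z wz; rewrite /red_avoid (perm_all _ (trace_eq_perm wz)).
rewrite (reduced_trace_eq wz); congr [&& _, _ & _].
by apply: eq_forallb => x; rewrite (initial_trace_eq _ wz).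
Qed.

Lemma initial_mem a w : initial a w -> a \in w.
Proof.
by elim: w => //= x w IH; rewrite inE eq_sym => /orP[->|/andP[_ /IH ->]] //; rewrite orbT.
Qed.

Lemma num_avoid0 U X : num_avoid U X 0 = 1.
Proof.
rewrite /num_avoid /num_traces; have -> : 1 = size [:: [::] : seq A] by [].
apply/perm_size/uniq_perm; rewrite ?nf_words_uniq //.
move=> w; rewrite mem_nf_words inE size_eq0.
case: eqP => // ->; rewrite /red_avoid /=; apply/andP; split.
  by apply/forall_inP => x.
by rewrite -size_eq0 size_trace_nf.
Qed.

(** The initial letters of [a :: w] other than [a] are the initial letters of [w] that
    commute with [a]; hence this part of [X] is what remains to be avoided after [a]. *)
Definition link X a := [set x in X | c x a].

Lemma initial_cons_neq b a w : b != a ->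
  initial b (a :: w) = c b a && initial b w.
Proof. by rewrite /= eq_sym => /negPf ->. Qed.

(** The first summand counts the words for which [a] is not initial.  For the others,
    removing [a] is a bijection onto the second set; avoiding [inv a] there means
    that putting [a] back gives a reduced word. *)
Lemma num_avoid_rec U X a n : a \in U -> a \notin X ->
  num_avoid U X n.+1 =
    num_avoid U (a |: X) n.+1 + num_avoid U (inv a |: link X a) n.
Proof.
move=> aU aX; rewrite /num_avoid (num_traces_split _ (initial a)); congr addn.
  apply: eq_num_traces => w _; rewrite /red_avoid /= -!andbA; do 2!congr andb.
  apply/andP/forall_inP => [[/forall_inP H na] x|H].
    by rewrite in_setU1 => /orP[/eqP->|/H].
  by split; [apply/forall_inP => x xX; apply: H; rewrite in_setU1 xX orbT
            | apply: H; rewrite setU11].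
set Q := fun w : seq A => red_avoid U X w && initial a w; rewrite -/(num_traces Q _).
have Qinv : trace_invariant Q.
  move=> w z wz; rewrite /Q /= (red_avoid_inv U X wz); congr andb.
  exact: initial_trace_eq.
apply/eqP; rewrite eqn_leq; apply/andP; split.
- apply: (@leq_num_traces Q (red_avoid U (inv a |: link X a)) (rem a)).
  + exact: red_avoid_inv.
  + move=> w sw /andP[/and3P[wU rw /forall_inP wX] iw].
    have aw := initial_mem iw; rewrite size_rem // sw; split=> //.
    have /andP[rr nia] := reduced_rem rw iw.
    apply/and3P; split=> //.
      by apply/allP => x /mem_rem; exact: (allP wU).
    apply/forall_inP => x; rewrite in_setU1 => /orP[/eqP-> //|].
    rewrite inE => /andP[xX cxa]; apply: contra (wX x xX) => ix.
    by rewrite (initial_trace_eq _ (rem_initial iw)) initial_cons_neq ?cxa ?c_neq.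
  + move=> w z _ _ /andP[_ iw] /andP[_ iz]; rewrite -(trace_eq_cons a) => E.
    apply: trace_eq_trans (rem_initial iw) (trace_eq_trans E _).
    by rewrite trace_eq_sym rem_initial.
- apply: (@leq_num_traces (red_avoid U (inv a |: link X a)) Q (cons a)) => //.
  + move=> w sw /and3P[wU rw /forall_inP wX]; rewrite /= sw; split=> //.
    rewrite /Q /= eqxx andbT; apply/and3P; split; rewrite /= ?aU //.
      by rewrite rw wX // setU11.
    apply/forall_inP => x xX; have xa : x != a by apply: contraNneq aX => <-.
    rewrite eq_sym (negPf xa) /=; apply/negP => /andP[cxa].
    by apply/negP/wX; rewrite !inE xX cxa orbT.
  + by move=> w z _ _ _ _; rewrite trace_eq_cons.
Qed.

Lemma num_avoid_full U n : num_avoid U U n.+1 = 0.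
Proof.
rewrite /num_avoid /num_traces; apply/eqP; rewrite size_eq0; apply/eqP.
case E: (nf_words _ _) => [//|w s].
have : w \in nf_words n.+1 (red_avoid U U) by rewrite E inE eqxx.
rewrite mem_nf_words => /and3P[]; case: w {E} => // x w _ /and3P[/= /andP[xU _] _].
by move=> /forall_inP/(_ x xU); rewrite /= eqxx.
Qed.

(** * The renewal equation at a vertex *)

Definition conv (f g : nat -> nat) n := \sum_(i < n.+1) f i * g (n - i).

Lemma convC f g n : conv f g n = conv g f n.
Proof.
rewrite /conv (reindex_inj rev_ord_inj) /=; apply: eq_bigr => i _.
by rewrite subSS subKn 1?mulnC // -ltnS.
Qed.

Lemma conv_rec f f1 f2 g n : f 0 = f1 0 ->
  (forall i, f i.+1 = f1 i.+1 + f2 i) ->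
  conv f g n.+1 = conv f1 g n.+1 + conv f2 g n.
Proof.
move=> f0 fS; rewrite /conv big_ord_recl [in RHS]big_ord_recl f0 -addnA.
congr addn; rewrite -big_split /=; apply: eq_bigr => i _.
by rewrite /bump add1n fS subSS mulnDl.
Qed.


Definition inv_closed U := forall a, a \in U -> inv a \in U.

(** In terms of generating functions, the series of [num_avoid U X] is the series of
    [num_avoid U set0] times a factor that depends on [X] only: the recursion
    [num_avoid_rec] for peeling off the letters of [X] does not mention [U].  Comparing
    two alphabets avoids naming this factor, which is the inverse of the growth series
    of [X] if [X] is closed under inversion. *)
Lemma conv_num_avoid U1 U2 X n : inv_closed U1 -> inv_closed U2 ->
  X \subset U1 -> X \subset U2 ->
  conv (num_avoid U1 X) (num_avoid U2 set0) n =
  conv (num_avoid U2 X) (num_avoid U1 set0) n.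
Proof.
move=> U1i U2i; have [k] := ubnP #|X|.
elim: n X k => [|n IHn] X k; first by rewrite /conv !big_ord1 !num_avoid0.
elim: k X => // k IHk X XS XU1 XU2.
have [->|[a aX]] := set_0Vmem X; first exact: convC.
have EX : X = a |: (X :\ a) by rewrite setD1K.
have linkX : link (X :\ a) a \subset X.
  by apply/subsetP => x; rewrite !inE => /andP[/andP[]].
have rec U : X \subset U -> forall i,
    num_avoid U (X :\ a) i.+1 =
      num_avoid U X i.+1 + num_avoid U (inv a |: link (X :\ a) a) i.
  move=> XU i; rewrite (@num_avoid_rec U (X :\ a) a) -?EX //;
    last by rewrite !inE eqxx.
  exact: (subsetP XU).
have sub U : inv_closed U -> X \subset U -> inv a |: link (X :\ a) a \subset U.
  move=> Ui XU; rewrite subUset sub1set Ui ?(subsetP XU) //=.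
  exact: subset_trans linkX XU.
have : conv (num_avoid U1 (X :\ a)) (num_avoid U2 set0) n.+1 =
       conv (num_avoid U2 (X :\ a)) (num_avoid U1 set0) n.+1.
  apply: IHk; rewrite ?(subset_trans (subsetDl _ _)) //.
  by rewrite (cardsD1 a X) aX in XS.
rewrite (conv_rec _ _ _ (rec _ XU1)) ?num_avoid0 //.
rewrite (conv_rec _ _ _ (rec _ XU2)) ?num_avoid0 //.
by rewrite (IHn (inv a |: link (X :\ a) a) _ (ltnSn _)) ?sub // => /addIn.
Qed.

Lemma conv_delta f g n : f 0 = 1 -> (forall i, f i.+1 = 0) -> conv f g n = g n.
Proof.
move=> f0 fS; rewrite /conv big_ord_recl f0 mul1n subn0 big1 ?addn0 // => i _.
by rewrite lift0 fS mul0n.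
Qed.

Section Vertex.
Variable v : A.
Let W := ~: [set v; inv v].
Let K := link W v.
Let m := #|[set v; inv v]|.

Lemma compl_vertex_inv_closed : inv_closed W.
Proof.
move=> a; rewrite !inE; apply: contra => /orP[]/eqP.
  by move=> <-; rewrite invK eqxx orbT.
by move/(can_inj invK)->; rewrite eqxx.
Qed.

Lemma vertex_notin_link : (v \notin K) * (inv v \notin K).
Proof. by rewrite !inE !eqxx /= orbT. Qed.

Lemma link_link_vertex :
  (link K v = K) * (link K (inv v) = K) * (link W (inv v) = K).
Proof.
split; [split|]; apply/setP => x; rewrite !inE ?c_inv //;
  by case: (c x v); rewrite ?andbF ?andbT.
Qed.


Let recK a n : a \in [set v; inv v] ->
  num_avoid setT K n.+1 =
    num_avoid setT (a |: K) n.+1 + num_avoid setT (inv a |: K) n.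
Proof.
rewrite !inE => /orP[]/eqP->; 
  first by rewrite (@num_avoid_rec _ K v) ?vertex_notin_link ?link_link_vertex.
by rewrite (@num_avoid_rec _ K (inv v)) ?vertex_notin_link ?link_link_vertex.
Qed.

(** Both sides are obtained from the same sequence by the same recursion, [v] and [inv v]
    being exchanged. *)
Lemma num_avoid_link_inv n :
  num_avoid setT (v |: K) n = num_avoid setT (inv v |: K) n.
Proof.
elim: n => [|n IH]; first by rewrite !num_avoid0.
apply: (@addIn (num_avoid setT (inv v |: K) n)).
rewrite -recK ?inE ?eqxx // (@recK (inv v)) ?inE ?eqxx ?orbT //.
by rewrite invK IH.
Qed.

(** A nonempty element without initial letter in [W] starts with one of the [m] letters of
    the vertex of [v], and with nothing else. *)
Lemma num_avoid_compl n : num_avoid setT W n.+1 = m * num_avoid setT (v |: K) n.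
Proof.
have vW : v \notin W by rewrite !inE eqxx.
rewrite (@num_avoid_rec _ W v) ?in_setT // -/K -num_avoid_link_inv /m cards2.
have [vv|vv] := eqVneq v (inv v).
  have -> : v |: W = setT.
    by apply/setP => x; rewrite /W !inE -vv orbb orbN.
  by rewrite num_avoid_full mul1n.
rewrite (@num_avoid_rec _ (v |: W) (inv v)) ?in_setT //; last first.
  by rewrite /W !inE eqxx orbT orbF eq_sym.
have -> : inv v |: (v |: W) = setT.
  by apply/setP => x; rewrite !inE; case: (x == v); case: (x == inv v).
rewrite num_avoid_full add0n invK; have -> : link (v |: W) (inv v) = K.
  apply/setP => x; rewrite !inE c_inv; case: eqP => [->|]; last by [].
  by rewrite c_irr andbF.
by rewrite mul2n addnn.
Qed.

(** Over [W] only the empty word avoids [W], so by [conv_num_avoid] the elements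
    avoiding [W] have the growth series of the whole group divided by that of [W]; by
    the same lemma those avoiding [K] have the series of [num_avoid W K] times this
    quotient.  The two kinds of elements are related by removing a letter of the vertex
    of [v] ([num_avoid_compl] and [num_avoid_rec]). *)
Lemma vertex_renewal n :
  num_avoid setT set0 n.+1 + num_avoid setT set0 n =
  num_avoid W set0 n.+1 + num_avoid W set0 n +
  m * conv (num_avoid W K) (num_avoid setT set0) n.
Proof.
have Wi := compl_vertex_inv_closed.
have Ti : inv_closed setT by [].
have KW : K \subset W by apply/subsetP => x; rewrite inE => /andP[].
have sE k : conv (num_avoid setT W) (num_avoid W set0) k = num_avoid setT set0 k.
  rewrite conv_num_avoid ?subsetT // conv_delta ?num_avoid0 // => i.
  exact: num_avoid_full.
have tE k : conv (num_avoid setT K) (num_avoid W set0) k =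
            conv (num_avoid W K) (num_avoid setT set0) k.
  by rewrite conv_num_avoid ?subsetT.
have GE k : num_avoid setT set0 k.+1 =
    num_avoid W set0 k.+1 + m * conv (num_avoid setT (v |: K)) (num_avoid W set0) k.
  rewrite -sE {1}/conv big_ord_recl num_avoid0 mul1n subn0; congr addn.
  rewrite /conv big_distrr /=; apply: eq_bigr => i _.
  by rewrite /bump add1n subSS num_avoid_compl mulnA.
have KE k : conv (num_avoid setT K) (num_avoid W set0) k.+1 =
    conv (num_avoid setT (v |: K)) (num_avoid W set0) k.+1 +
    conv (num_avoid setT (v |: K)) (num_avoid W set0) k.
  by apply: conv_rec => [|i]; rewrite ?num_avoid0 // (@recK v) ?inE ?eqxx //
    -num_avoid_link_inv.
case: n => [|n].
  by rewrite GE /conv !big_ord1 !num_avoid0 !muln1 addnAC.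
by rewrite !GE -tE KE mulnDr addnACA.
Qed.

End Vertex.


(** * Comparison of the counting sequences *)

Lemma initial_cat a w z : initial a w -> initial a (w ++ z).
Proof.
by elim: w => //= x w IH /orP[->//|/andP[-> /IH->]]; rewrite orbT.
Qed.

Lemma reduced_cat w z : reduced (w ++ z) -> reduced w && reduced z.
Proof.
elim: w => //= x w IH /andP[ni /IH/andP[-> ->]]; rewrite !andbT.
by apply: contra ni; exact: initial_cat.
Qed.

Lemma red_avoid0 U w : red_avoid U set0 w = all (mem U) w && reduced w.
Proof.
rewrite /red_avoid; have -> : [forall x in set0, ~~ initial x w].
  by apply/forall_inP => x; rewrite inE.
by rewrite andbT.
Qed.

(** A word is determined by its prefix and suffix of given lengths, and so is a trace by
    the traces of the two parts of its representative. *)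
Lemma num_avoid_submul U n m :
  num_avoid U set0 (n + m) <= num_avoid U set0 n * num_avoid U set0 m.
Proof.
rewrite /num_avoid /num_traces -(size_allpairs (@pair (seq A) (seq A))).
pose f (w : seq A) := (trace_nf (take n w), trace_nf (drop n w)).
rewrite -(size_map f); apply: uniq_leq_size.
  rewrite map_inj_in_uniq ?nf_words_uniq // => w z.
  rewrite !mem_nf_words => /and3P[_ _ /eqP Ew] /and3P[_ _ /eqP Ez].
  case=> /eqP; rewrite eq_trace_nf => E /eqP; rewrite eq_trace_nf => F.
  rewrite -Ew -Ez; apply/eqP; rewrite eq_trace_nf.
  by rewrite -(cat_take_drop n w) -(cat_take_drop n z); exact: trace_eq_cat.
move=> q /mapP[w]; rewrite mem_nf_words red_avoid0.
move=> /and3P[/eqP sw /andP[wU rw] _] ->{q}.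
rewrite -(cat_take_drop n w) all_cat in wU rw.
case/andP: wU => tU dU; case/andP: (reduced_cat rw) => tr dr.
apply: allpairs_f; rewrite mem_nf_words size_trace_nf trace_nfK eqxx andbT.
  by rewrite size_takel ?sw ?leq_addr // eqxx
    -(red_avoid_inv _ _ (trace_nf_eq _)) red_avoid0 tU.
by rewrite size_drop sw addKn eqxx
  -(red_avoid_inv _ _ (trace_nf_eq _)) red_avoid0 dU.
Qed.

Lemma num_avoid_le U X n : num_avoid U X n <= num_avoid U set0 n.
Proof.
apply: (@leq_num_traces _ _ id) => // [|w sw /and3P[wU rw _]].
  exact: red_avoid_inv.
by rewrite red_avoid0 wU rw.
Qed.

(** After [a], the letter [b] neither cancels nor moves in front of [a]. *)
Definition linked a b := ~~ c a b && (b != inv a).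

Lemma linked_sym : symmetric linked.
Proof.
move=> a b; rewrite /linked c_sym; congr (_ && ~~ _).
by apply/eqP/eqP => ->; rewrite invK.
Qed.

Lemma initial_linked a b w : linked a b -> initial (inv a) (b :: w) = false.
Proof. by case/andP => /negPf nc /negPf n /=; rewrite n c_invl nc. Qed.

Lemma initial_comm a b w : initial a w -> initial b w -> a != b -> c a b.
Proof.
move=> ia; rewrite (initial_trace_eq _ (rem_initial ia)) => /= /orP[->//|].
by rewrite c_sym => /andP[].
Qed.

Lemma reduced_walk x p w : path linked x p -> reduced w ->
  ~~ initial (inv (last x p)) w -> reduced (x :: p ++ w).
Proof.
elim: p x => [|y p IH] x; first by move=> _ /= -> ->.
case/andP => xy yp rw ni.
rewrite -[reduced _]/(~~ initial (inv x) (y :: p ++ w) && reduced (y :: p ++ w)).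
by rewrite initial_linked ?IH.
Qed.

(** A letter can move to the front of a walk that meets a letter not commuting with it
    only by being the first letter of the walk, as consecutive letters of the walk block
    each other. *)
Lemma initial_walk b x p w : path linked x p ->
  has (fun y => ~~ c b y) (x :: p) -> initial b (x :: p ++ w) -> b = x.
Proof.
elim: p x => [|y p IH] x.
  by move=> _ /=; rewrite orbF eq_sym => /negPf ->; rewrite orbF => /eqP.
move=> /= /andP[xy yp] hb; case: eqVneq => [->//|_] /= /andP[cbx ib].
rewrite cbx /= in hb; have by_ := IH y yp hb ib.
by case/andP: xy; rewrite c_sym -by_ cbx.
Qed.

(** Prepend a walk that meets, for each letter, a letter not commuting with it: by
    [initial_walk] only its first letter is initial in the result.  The result fails to
    be reduced only if the inverse of the last letter of the walk is initial in the given
    word.  Two walks are used because the inverses of two distinct noncommuting letters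
    are never both initial, so that one of the two walks always works. *)
Lemma num_avoid_two_walks U X x1 p1 x2 p2 n :
  let covers x p := {in U, forall b, has (fun y => ~~ c b y) (x :: p)} in
  X \subset U ->
  path linked x1 p1 -> path linked x2 p2 ->
  {subset x1 :: p1 <= U} -> {subset x2 :: p2 <= U} ->
  covers x1 p1 -> covers x2 p2 -> x1 \notin X -> x2 \notin X ->
  last x1 p1 != last x2 p2 -> ~~ c (last x1 p1) (last x2 p2) ->
  num_avoid U set0 n <=
  num_avoid U X ((size p1).+1 + n) + num_avoid U X ((size p2).+1 + n).
Proof.
move=> covers XU P1 P2 U1 U2 C1 C2 X1 X2 l12 nc12.
rewrite {1}/num_avoid (num_traces_split _ (initial (inv (last x1 p1)))).
have walk x p (P : pred (seq A)) : path linked x p -> {subset x :: p <= U} ->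
    covers x p -> x \notin X ->
    (forall w, P w ->
       [/\ all (mem U) w, reduced w & ~~ initial (inv (last x p)) w]) ->
    num_traces P n <= num_avoid U X ((size p).+1 + n).
  move=> Pxp Uxp Cxp xX HP.
  apply: (@leq_num_traces _ _ (cat (x :: p))); first exact: red_avoid_inv.
    move=> w sw /HP[wU rw ni]; rewrite size_cat sw; split=> //.
    apply/and3P; split; first by rewrite all_cat wU andbT; apply/allP.
      exact: reduced_walk.
    apply/forall_inP => b bX; apply: contraNN xX => /initial_walk <- //.
    exact/Cxp/(subsetP XU).
  by move=> w z _ _ _ _; rewrite trace_eq_catl.
apply: leq_add; [apply: (walk x1) | apply: (walk x2)] => // w;
  rewrite red_avoid0 => /andP[/andP[wU rw] i1]; first by [].
split=> //; apply: contra nc12 => i2.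
by have := initial_comm i1 i2; rewrite c_inv c_invl (can_eq invK); apply.
Qed.

Fixpoint alternating n a b := if n is n'.+1 then a :: alternating n' b a else [::].

Lemma size_alternating n a b : size (alternating n a b) = n.
Proof. by elim: n a b => //= n IH a b; rewrite IH. Qed.

Lemma mem_alternating n a b x : x \in alternating n a b -> x \in pred2 a b.
Proof.
elim: n a b => //= n IH a b; rewrite in_cons => /orP[/eqP->|/IH].
  by rewrite inE eqxx.
by rewrite !inE orbC.
Qed.

Lemma num_avoid_gt0 U X a b n : a \in U -> b \in U -> a \notin X -> linked a b ->
  0 < num_avoid U X n.
Proof.
move=> aU bU aX ab; apply: (num_traces_gt0 _ (size_alternating n a b)).
  exact: red_avoid_inv.
apply/and3P; split.
- by apply/allP => x /mem_alternating; rewrite !inE => /orP[]/eqP->.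
- elim: n a b {aU bU aX} ab => //= n IH a b; rewrite linked_sym => ba.
  rewrite (IH _ _ ba) andbT; case: n {IH} => //= n.
  by rewrite linked_sym in ba; rewrite -[_ || _]/(initial _ (_ :: _)) initial_linked.
apply/forall_inP => x xX; apply/negP => ix.
have := mem_alternating (initial_mem ix); rewrite !inE => /orP[]/eqP E.
  by rewrite -E xX in aX.
case: n ix => //= n; rewrite E -E; case: eqP => [ax|_] /=.
  by rewrite ax xX in aX.
by rewrite E c_sym; case/andP: ab => /negPf->.
Qed.

End Traces.

(** * Power series with nonnegative coefficients *)

Section PowerSums.
Variable R : realType.
Implicit Types (f w : nat -> R) (x y th : R).

Definition psum f N x := \sum_(i < N) f i * x ^+ i.

Lemma exprn_convex x y th n : 0 <= x -> 0 <= y -> 0 <= th <= 1 ->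
  ((1 - th) * x + th * y) ^+ n <= (1 - th) * x ^+ n + th * y ^+ n.
Proof.
move=> x0 y0 /andP[t0 t1]; elim: n => [|n IH].
  by rewrite !expr0 !mulr1 subrK.
have z0 : 0 <= (1 - th) * x + th * y by rewrite addr_ge0 ?mulr_ge0 ?subr_ge0.
rewrite exprS (le_trans (ler_wpM2l z0 IH)) // -subr_ge0.
have -> : (1 - th) * x ^+ n.+1 + th * y ^+ n.+1 -
    ((1 - th) * x + th * y) * ((1 - th) * x ^+ n + th * y ^+ n) =
    (1 - th) * th * ((x - y) * (x ^+ n - y ^+ n)) by rewrite !exprS; ring.
apply: mulr_ge0; first by rewrite mulr_ge0 ?subr_ge0.
have [xy|yx] := leP x y.
  by rewrite mulr_le0 // subr_le0 // lerXn2r // nnegrE.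
by rewrite mulr_ge0 // subr_ge0 ?lerXn2r ?nnegrE // ltW.
Qed.

(** Convexity serves below as an explicit form of continuity that is uniform in the number
    of terms. *)
Lemma psum_convex f N x y th : (forall i, 0 <= f i) ->
  0 <= x -> 0 <= y -> 0 <= th <= 1 ->
  psum f N ((1 - th) * x + th * y) <= (1 - th) * psum f N x + th * psum f N y.
Proof.
move=> f0 x0 y0 t01; rewrite /psum !mulr_sumr -big_split /=; apply: ler_sum => i _.
rewrite [leRHS](_ : _ = f i * ((1 - th) * x ^+ i + th * y ^+ i)); last by ring.
by rewrite ler_wpM2l // exprn_convex.
Qed.

Lemma psum_ge0 f N x : (forall i, 0 <= f i) -> 0 <= x -> 0 <= psum f N x.
Proof. by move=> f0 x0; apply: sumr_ge0 => i _; rewrite mulr_ge0 ?exprn_ge0. Qed.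

Lemma psum_mono f N x y : (forall i, 0 <= f i) -> 0 <= x -> x <= y ->
  psum f N x <= psum f N y.
Proof.
move=> f0 x0 xy; apply: ler_sum => i _; rewrite ler_wpM2l // lerXn2r // nnegrE //.
exact: le_trans xy.
Qed.

Lemma psum_cat f n N x :
  psum f (n + N) x = psum f n x + \sum_(i < N) f (n + i)%N * x ^+ (n + i).
Proof. by rewrite /psum big_split_ord. Qed.

Lemma psum_leq f n N x : (forall i, 0 <= f i) -> 0 <= x -> (n <= N)%N ->
  psum f n x <= psum f N x.
Proof.
move=> f0 x0 /subnKC <-; rewrite psum_cat lerDl.
by apply: sumr_ge0 => i _; rewrite mulr_ge0 ?exprn_ge0.
Qed.

Lemma psum0 f N : psum f N 0 <= `|f 0%N|.
Proof.
case: N => [|N]; first by rewrite /psum big_ord0.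
rewrite /psum big_ord_recl expr0 mulr1 big1 ?addr0 ?ler_norm // => i _.
by rewrite expr0n mulr0.
Qed.

(** Continuity from the left at [sup S], by convexity: [sup S] lies between some [y] in
    [S] and [y + 1], at a small distance [th] from [y]. *)
Lemma psum_sup_le f N (S : set R) b : (forall i, 0 <= f i) ->
  has_sup S -> (forall x, S x -> 0 <= x /\ psum f N x <= b) ->
  psum f N (sup S) <= b.
Proof.
move=> f0 Ssup Sb; set x0 := sup S.
have le_x0 x : S x -> x <= x0 by move=> Sx; apply: (sup_upper_bound Ssup).
set M := psum f N (x0 + 1).
have x00 : 0 <= x0.
  by have [[x Sx] _] := Ssup; have [x0' _] := Sb x Sx; apply: le_trans (le_x0 x Sx).
have M0 : 0 <= M by apply: psum_ge0 => //; lra.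
have b0 : 0 <= b.
  have [[x Sx] _] := Ssup; have [xx0 xb] := Sb x Sx.
  by apply: le_trans xb; exact: psum_ge0.
apply/ler_addgt0Pr => eps e0.
have d0 : 0 < Num.min 1 (eps / (M + 1)).
  by rewrite lt_min ltr01 divr_gt0 //; lra.
have [y Sy y_gt] := sup_adherent d0 Ssup.
have [y0 yb] := Sb y Sy; have yx0 := le_x0 y Sy.
pose th := x0 - y.
have th01 : 0 <= th <= 1.
  apply/andP; split; first by rewrite subr_ge0.
  have : Num.min 1 (eps / (M + 1)) <= 1 by rewrite ge_min lexx.
  by rewrite /th /x0; lra.
have thM : th * M <= eps.
  have : th <= eps / (M + 1).
    have : Num.min 1 (eps / (M + 1)) <= eps / (M + 1) by rewrite ge_min lexx orbT.
    by rewrite /th /x0; lra.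
  rewrite ler_pdivlMr; last by lra.
  by move: th01 => /andP[? ?]; nra.
have -> : x0 = (1 - th) * y + th * (y + 1) by rewrite /th; ring.
apply: le_trans (psum_convex _ f0 y0 _ th01) _; first by lra.
have yM : psum f N (y + 1) <= M by apply: psum_mono => //; lra.
case/andP: th01 => t0 t1.
have : th * psum f N (y + 1) <= th * M by rewrite ler_wpM2l.
have : (1 - th) * psum f N y <= 1 * b.
  by apply: ler_pM => //; [lra | exact: psum_ge0 | lra].
lra.
Qed.

(** Some term [w n * x ^+ n] is at most 1/2, hence at most 3/4 slightly to the right of
    [x]; by submultiplicativity, blocks of [n] consecutive terms then decrease
    geometrically. *)
Lemma psum_submul_open w x B : (forall i, 0 <= w i) ->
  (forall i j, w (i + j)%N <= w i * w j) -> 0 <= x ->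
  (forall N, psum w N x <= B) ->
  exists2 y, x < y & exists B', forall N, psum w N y <= B'.
Proof.
move=> w0 wM x0 xB.
have [n wn] : exists n, w n * x ^+ n <= 2^-1.
  apply/not_existsP => H; have {}H n : 2^-1 < w n * x ^+ n by rewrite ltNge; apply/negP/H.
  have B0 : 0 <= B by have := xB 0%N; rewrite /psum big_ord0.
  pose K := (Num.bound B).*2; have := xB K.
  have : \sum_(i < K) (2^-1 : R) <= psum w K x by apply: ler_sum => i _; exact: ltW.
  rewrite sumr_const card_ord => /le_trans H1 /H1.
  rewrite /K -mul2n mulrnA -[2^-1 *+ 2]mulr_natr mulVf ?pnatr_eq0 //.
  by have := archi_boundP B0 => /lt_le_trans H2 /H2; rewrite ltxx.
(* [M] bounds the slope of the chord of the [n]-th term over [[x, x + 1]]. *)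
pose M := w n * (x + 1) ^+ n.
have M0 : 0 <= M by rewrite mulr_ge0 ?exprn_ge0 //; lra.
pose th := (4 * (M + 1))^-1.
have th0 : 0 < th by rewrite invr_gt0; lra.
have thE : th * (4 * (M + 1)) = 1 by rewrite mulVf //; lra.
have th1 : th <= 1 by nra.
exists (x + th); first by lra.
set y := x + th; have y0 : 0 <= y by rewrite /y; lra.
have wny : w n * y ^+ n <= 3 / 4.
  have -> : y = (1 - th) * x + th * (x + 1) by rewrite /y; ring.
  have x10 : 0 <= x + 1 by lra.
  have th01 : 0 <= th <= 1 by apply/andP; split; lra.
  apply: le_trans (ler_wpM2l (w0 n) (exprn_convex n x0 x10 th01)) _.
  rewrite mulrDr !(mulrCA (w n)) -/M.
  have := mulr_ge0 (w0 n) (exprn_ge0 n x0).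
  by nra.
exists (4 * psum w n y) => N.
have : psum w N y <= psum w (n + N) y by apply: psum_leq; rewrite ?leq_addl.
rewrite psum_cat.
have : \sum_(i < N) w (n + i)%N * y ^+ (n + i) <= 3 / 4 * psum w N y.
  apply: (@le_trans _ _ ((w n * y ^+ n) * psum w N y)).
    rewrite /psum mulr_sumr; apply: ler_sum => i _.
    rewrite exprD mulrACA ler_wpM2r ?mulr_ge0 ?exprn_ge0 //.
  by rewrite ler_wpM2r // psum_ge0.
lra.
Qed.

End PowerSums.

(** * The critical radius *)

Section CriticalRadius.
Variables (R : realType) (w t : nat -> R) (m : R) (k1 k2 : nat).
Hypothesis w_submul : forall i j, w (i + j)%N <= w i * w j.
Hypothesis t_ge1 : forall i, 1 <= t i.
Hypothesis t_le_w : forall i, t i <= w i.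
Hypothesis w_le_t : forall i, w i <= t (k1 + i)%N + t (k2 + i)%N.
Hypothesis m_ge1 : 1 <= m.

(** The coefficients of [F(x) = m x t(x) - x]. *)
Definition renewal_kernel (n : nat) : R :=
  if n is n'.+1 then m * t n' - (n' == 0)%:R else 0.
Local Notation F := renewal_kernel.

Let t_ge0 i : 0 <= t i. Proof. exact: le_trans (t_ge1 i). Qed.
Let w_ge0 i : 0 <= w i. Proof. exact: le_trans (t_ge0 i) (t_le_w i). Qed.

Lemma renewal_kernel_gt0 n : 1 <= F n.+2.
Proof. by rewrite /F /= subr0; have := t_ge1 n.+1; have := m_ge1; nra. Qed.

Lemma renewal_kernel_ge0 n : 0 <= F n.
Proof.
case: n => [|[|n]] //; last by apply: le_trans (renewal_kernel_gt0 n).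
by rewrite /F /=; have := t_ge1 0; have := m_ge1; nra.
Qed.

Lemma renewal_kernel_le n : F n.+1 <= m * w n.
Proof.
rewrite /F lerBlDr; apply: (@le_trans _ _ (m * w n)); last by rewrite lerDl.
by rewrite ler_wpM2l //; apply: le_trans m_ge1.
Qed.

Lemma psum_shift (f : nat -> R) N x :
  psum f N.+1 x = f 0%N + x * psum (f \o succn) N x.
Proof.
rewrite /psum big_ord_recl expr0 mulr1 mulr_sumr; congr +%R.
by apply: eq_bigr => i _; rewrite lift0 /= exprS mulrCA.
Qed.

Lemma psum_renewal_kernel_le N x : 0 <= x -> psum F N x <= m * x * psum w N x.
Proof.
move=> x0; apply: (@le_trans _ _ (psum F N.+1 x)).
  by apply: psum_leq => //; exact: renewal_kernel_ge0.
rewrite psum_shift add0r [m * x]mulrC -mulrA ler_wpM2l // /psum mulr_sumr.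
by apply: ler_sum => i _; rewrite mulrA ler_wpM2r ?exprn_ge0 ?renewal_kernel_le.
Qed.

(** [F] controls [t] termwise, and [t] controls [w] up to two shifts of the index. *)
Lemma psum_w_le x N : 0 < x -> (forall M, psum F M x <= 1) ->
  psum w N x <= (1 + x) / x * ((x ^+ k1)^-1 + (x ^+ k2)^-1).
Proof.
move=> x0 Fx.
have tx M : psum t M x <= (1 + x) / x.
  rewrite ler_pdivlMr // mulrC.
  have := Fx M.+1; rewrite psum_shift add0r.
  have : psum t M x <= psum (F \o succn) M x + 1.
    case: M => [|M].
      rewrite /psum !big_ord0; lra.
    rewrite !psum_shift /= /F /=.
    have : t 0 <= m * t 0 by have := t_ge1 0; have := m_ge1; nra.
    have : psum (t \o succn) M x <=
      psum ((fun n : nat => m * t n - (n == 0)%:R) \o succn) M x.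
      apply: ler_sum => i _; rewrite /= subr0 ler_wpM2r ?exprn_ge0 ?(ltW x0) //.
      by rewrite ler_peMl // t_ge0.
    by move=> /(ler_wpM2l (ltW x0)); lra.
  by move=> /(ler_wpM2l (ltW x0)); lra.
have tk k M : \sum_(i < M) t (k + i)%N * x ^+ i <= (1 + x) / x * (x ^+ k)^-1.
  rewrite ler_pdivlMr ?exprn_gt0 //; apply: le_trans (tx (k + M)%N).
  rewrite psum_cat mulr_suml -[leLHS]add0r lerD //.
    by apply: psum_ge0; [exact: t_ge0 | exact: ltW].
  by apply: ler_sum => i _; rewrite -mulrA -exprD addnC.
rewrite mulrDr; apply: le_trans (lerD (tk k1 N) (tk k2 N)).
rewrite -big_split /=; apply: ler_sum => i _.
by rewrite -mulrDl ler_wpM2r ?exprn_ge0 // ltW.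
Qed.

(** [x0] is the supremum of the points where the partial sums of [F] stay below 1.  There
    [w] still converges, hence it converges at some [x1 > x0], and so does [F].  If the
    sums of [F] at [x0] stayed away from 1, convexity between [x0] and [x1] would keep
    them below 1 slightly to the right of [x0]. *)
Lemma critical_radius : exists x0 x1 B : R,
  [/\ 0 < x0 < 1, x0 < x1,
      forall N, psum F N x0 <= 1,
      forall N, psum F N x1 <= B /\ psum w N x1 <= B &
      forall eta, 0 < eta -> exists N, 1 - eta < psum F N x0].
Proof.
have F0 := renewal_kernel_ge0.
pose S := [set x : R | 0 <= x /\ forall N, psum F N x <= 1].
have S0 : S 0.
  by split=> // N; apply: le_trans (psum0 _ _) _; rewrite /F normr0.
have S_lt1 x : S x -> x < 1.
  have psum4 (f : nat -> R) :
      psum f 4 x = f 0%N + f 1%N * x + f 2%N * x ^+ 2 + f 3%N * x ^+ 3.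
    by rewrite /psum !big_ord_recr big_ord0 /= add0r expr0 expr1 mulr1.
  move=> [x0 /(_ 4%N)]; rewrite psum4 => H.
  rewrite ltNge; apply/negP => x1; move: H; apply/negP; rewrite -ltNge.
  have := F0 1%N; have := F0 0%N => F00 F1.
  have := renewal_kernel_gt0 0; have := renewal_kernel_gt0 1 => F3 F2.
  have x2 : 1 <= x ^+ 2 by rewrite expr_ge1.
  have x3 : 1 <= x ^+ 3 by rewrite expr_ge1.
  have : 0 <= F 1 * x by rewrite mulr_ge0.
  have : 1 <= F 2 * x ^+ 2 by rewrite mulr_ege1.
  have : 1 <= F 3 * x ^+ 3 by rewrite mulr_ege1.
  by lra.
have supS : has_sup S.
  by split; [exists 0 | exists 1 => x /S_lt1/ltW].
pose x0 := sup S.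
have x0_ge0 : 0 <= x0 by apply: (sup_upper_bound supS).
have x0F N : psum F N x0 <= 1.
  by apply: psum_sup_le => // x [xx0 xF]; split.
have Sx0 : S x0 by [].
have x0_lt1 := S_lt1 _ Sx0.
have [B wB] : exists B, forall N, psum w N x0 <= B.
  move: x0_ge0; rewrite le_eqVlt => /predU1P[<-|x0_gt0].
    by exists `|w 0%N| => N; exact: psum0.
  by eexists => N; exact: psum_w_le.
have [x1 x01 [B' wB']] := psum_submul_open w_ge0 w_submul x0_ge0 wB.
have x1_ge0 : 0 <= x1 by lra.
pose B1 := B' + m * x1 * B' + 1.
have B'0 : 0 <= B' by apply: le_trans (wB' 0%N); exact: psum_ge0 w_ge0 _.
have mx1 : 0 <= m * x1 by rewrite mulr_ge0 //; have := m_ge1; lra.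
have FB N : psum F N x1 <= B1.
  apply: le_trans (psum_renewal_kernel_le _ x1_ge0) _.
  by have := ler_wpM2l mx1 (wB' N); rewrite /B1; lra.
have tight eta : 0 < eta -> exists N, 1 - eta < psum F N x0.
  move=> e0; apply/not_existsP => H.
  have {}H N : psum F N x0 <= 1 - eta by rewrite leNgt; apply/negP/H.
  have B10 : 0 <= B1 by rewrite /B1; have := mulr_ge0 mx1 B'0; lra.
  pose th := Num.min 1 (eta / (B1 + 1)).
  have th0 : 0 < th by rewrite lt_min ltr01 divr_gt0 //; lra.
  have th01 : 0 <= th <= 1 by rewrite (ltW th0) ge_min lexx.
  have thB : th * (B1 + 1) <= eta by rewrite -ler_pdivlMr ?ge_min ?lexx ?orbT //; lra.
  have : S ((1 - th) * x0 + th * x1).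
    split; first by case/andP: th01 => ? ?; rewrite addr_ge0 ?mulr_ge0 ?subr_ge0.
    move=> N; apply: le_trans (psum_convex N F0 x0_ge0 x1_ge0 th01) _.
    case/andP: th01 => t0 t1; have := ler_wpM2l t0 (FB N).
    have : (1 - th) * psum F N x0 <= psum F N x0.
      by rewrite ler_piMl ?psum_ge0 //; lra.
    by have := H N; lra.
  move/(sup_upper_bound supS); rewrite -/x0 leNgt => /negP; apply.
  by nra.
exists x0, x1, B1; split=> //.
- rewrite x0_lt1 andbT lt_neqAle x0_ge0 andbT; apply/eqP => E.
  have [|N] := tight 2^-1; first by rewrite invr_gt0.
  by have := psum0 F N; rewrite -E /= normr0; lra.
- move=> N; split=> //; apply: le_trans (wB' N) _; rewrite /B1.
  by have := mulr_ge0 mx1 B'0; lra.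
Qed.

End CriticalRadius.

(** * The renewal theorem *)

Lemma cvgn_dist (R : realType) (f : nat -> R) (l eps : R) : f @ \oo --> l ->
  0 < eps -> exists n0, forall n, (n0 <= n)%N -> `|l - f n| <= eps.
Proof.
by move=> /cvgrPdist_le /[apply] -[n0 _ H]; exists n0 => n; exact: H.
Qed.

Section Renewal.
Variables (R : realType) (p q : nat -> R) (mu : R).
(* [p k] is the weight of [k + 1] and [q k] that of all values above [k], so that the sum
   [mu] of [q] is the mean. *)
Hypothesis p_ge0 : forall k, 0 <= p k.
Hypothesis p_gt0 : forall k, 0 < p k.+1.
Hypothesis q0 : q 0%N = 1.
Hypothesis qS : forall k, q k.+1 = q k - p k.
Hypothesis q_ge0 : forall k, 0 <= q k.
Hypothesis q_sum : series q @ \oo --> mu.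

Lemma sum_weights K : \sum_(i < K) p i = 1 - q K.
Proof.
elim: K => [|K IH]; first by rewrite big_ord0 q0 subrr.
by rewrite big_ord_recr /= IH qS; ring.
Qed.

Lemma sum_weights_tail L N : (L <= N)%N -> \sum_(L <= i < N) p i = q L - q N.
Proof.
move=> LN; have := sum_weights N; rewrite -(big_mkord predT p).
rewrite (big_cat_nat _ LN) //= big_mkord sum_weights; lra.
Qed.

Lemma tail_le n N : (n <= N)%N -> q N <= q n.
Proof.
move=> nN; rewrite -subr_ge0 -sum_weights_tail //.
by apply: sumr_ge0.
Qed.

Lemma tail_cvg0 : q @ \oo --> (0 : R).
Proof. by apply: cvg_series_cvg_0; apply/cvg_ex; exists mu. Qed.

Lemma tail_sum_ge1 : 1 <= mu.
Proof.
have qmu : limn (series q) = mu by apply: cvg_lim q_sum; exact: Rhausdorff.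
rewrite -qmu -q0; apply: limr_ge; first by apply/cvg_ex; exists mu.
exists 1%N => // n /= n1; rewrite /series /= big_ltn //.
by rewrite lerDl; apply: sumr_ge0.
Qed.

Section LimSup.
Variables (h u : nat -> R) (B H : R).
Hypothesis u_bound : forall n, `|u n| <= B.
Hypothesis u_rec :
  forall n, u n.+1 = h n.+1 + \sum_(i < n.+1) p i * u (n - i)%N.
Hypothesis h_cvg0 : h @ \oo --> (0 : R).
Hypothesis qu_cvg : (fun n => \sum_(i < n.+1) q i * u (n - i)%N) @ \oo --> H.

Let E := [set x : R | exists n0, forall n, (n0 <= n)%N -> u n <= x].
Let M := inf E.

Let B_ge0 : 0 <= B. Proof. exact: le_trans (u_bound 0). Qed.

Let infE : has_inf E.
Proof.
split; first by exists B; exists 0%N => n _; apply: le_trans (ler_norm _) _.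
exists (- B) => x [n0 /(_ _ (leqnn _))]; apply: le_trans.
by have := u_bound n0; rewrite ler_norml => /andP[].
Qed.

Let le_M (eps : R) : 0 < eps -> exists n0, forall n, (n0 <= n)%N -> u n <= M + eps.
Proof.
move=> e0; have [x [n0 Hx] xM] := inf_adherent e0 infE.
by exists n0 => n /Hx /le_trans; apply; exact: ltW.
Qed.

Let gt_M (eps : R) n0 : 0 < eps -> exists2 n, (n0 <= n)%N & M - eps < u n.
Proof.
move=> e0; apply/not_exists2P => K.
have : E (M - eps).
  by exists n0 => n n0n; have [//|/negP] := K n; rewrite -leNgt.
move/(inf_lbound infE.2); rewrite -/M; lra.
Qed.

(** The recursion writes [u n] as an average of earlier values, none of which exceeds the
    limit superior by much.  If [u n] is close to the limit superior, each earlier value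
    of positive weight must be close to it as well.  The weight [p 0] may vanish,
    so the values at distance at least 2 are used, after a shift of [n] by 2. *)
Lemma near_limsup K n0 (eps : R) : 0 < eps -> exists2 n, (n0 + K <= n)%N &
  forall k, (k < K)%N -> M - eps <= u (n - k)%N.
Proof.
move=> e0.
have [r r0 rP] : exists2 r, 0 < r & forall k, (k < K)%N -> r <= p k.+1.
  elim: K => [|K [r r0 rP]]; first by exists 1.
  exists (Num.min r (p K.+1)) => [|k]; first by rewrite lt_min r0 p_gt0.
  rewrite ltnS leq_eqVlt => /predU1P[->|/rP kr]; first by rewrite ge_min lexx orbT.
  by rewrite ge_min kr.
pose e1 := Num.min 1 (eps * r / 5).
have e1_gt0 : 0 < e1 by rewrite lt_min ltr01 divr_gt0 ?mulr_gt0.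
have e1_le1 : e1 <= 1 by rewrite ge_min lexx.
have e1_le : 5 * e1 <= eps * r.
  by have : e1 <= eps * r / 5; [rewrite ge_min lexx orbT | lra].
pose B' : R := `|M| + 1 + B.
have B'_gt0 : 0 < B' by rewrite /B'; have := normr_ge0 M; have := B_ge0; lra.
have [L0 HL] := cvgn_dist tail_cvg0 (divr_gt0 e1_gt0 B'_gt0).
pose L := (L0 + K).+1.
have qL : q L * B' <= e1.
  rewrite -ler_pdivlMr //; apply: le_trans (HL L _); last by clear; rewrite /L; lia.
  by rewrite sub0r normrN ler_norm.
have [n1 Hn1] := le_M e1_gt0.
have [n2 Hn2] := cvgn_dist h_cvg0 e1_gt0.
have [n'' Hn'' uM] := gt_M (n0 + n1 + n2 + L + K).+2 e1_gt0.
case: n'' Hn'' uM => [//|n'] Hn' uM.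
exists n'.-1 => [|k kK]; first by clear -Hn'; lia.
have -> : (n'.-1 - k = n' - k.+1)%N by clear; lia.
pose D i := M + e1 - u (n' - i)%N.
have nM : - `|M| <= M <= `|M| by rewrite -ler_norml.
have ubd n : - B <= u n <= B by rewrite -ler_norml.
have DB i : - B' <= D i.
  by have := ubd (n' - i)%N; have := nM; rewrite /B' /D; lra.
have D0 i : (i < L)%N -> 0 <= D i.
  by move=> iL; rewrite /D subr_ge0 Hn1 //; clear -Hn' iL; lia.
have sumD : \sum_(i < n'.+1) p i * D i <= 4 * e1.
  have -> : \sum_(i < n'.+1) p i * D i =
      (M + e1) * (1 - q n'.+1) - (u n'.+1 - h n'.+1).
    rewrite u_rec addrAC subrr add0r -sum_weights mulr_sumr -sumrB.
    by apply: eq_bigr => i _; rewrite /D; ring.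
  have : q n'.+1 <= q L by apply: tail_le; clear -Hn'; lia.
  have := Hn2 n'.+1; rewrite sub0r normrN => /(_ _)/(le_trans (ler_norm _)).
  have -> : (n2 <= n'.+1)%N by clear -Hn'; lia.
  move=> /(_ isT) h1 qq; have := q_ge0 n'.+1.
  have : - (M + e1) * q n'.+1 <= B' * q n'.+1.
    by rewrite ler_wpM2r // /B'; have := B_ge0; lra.
  have : B' * q n'.+1 <= B' * q L by rewrite ler_wpM2l // ltW.
  lra.
have Ln' : (L <= n'.+1)%N by clear -Hn'; lia.
have KL : (k.+1 < L)%N by clear -kK; rewrite /L; lia.
have : p k.+1 * D k.+1 - e1 <= \sum_(i < n'.+1) p i * D i.
  rewrite -(big_mkord predT (fun i => p i * D i)) (big_cat_nat _ Ln') //=.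
  rewrite big_mkord lerD //.
    rewrite (bigD1 (Ordinal KL)) //= lerDl.
    by apply: sumr_ge0 => i _; rewrite mulr_ge0 // D0.
  apply: (@le_trans _ _ (\sum_(L <= i < n'.+1) p i * - B')).
    rewrite -mulr_suml sum_weights_tail // mulrN lerN2 mulrBl; apply: le_trans qL.
    by rewrite gerBl mulr_ge0 // ltW.
  by apply: ler_sum => i _; rewrite ler_wpM2l.
move=> /le_trans/(_ sumD) pD.
have Dk := D0 _ KL; have rp := rP k kK.
have : r * D k.+1 <= eps * r.
  by have := ler_wpM2r Dk rp; lra.
by rewrite mulrC ler_pM2r // /D; lra.
Qed.

(** Along the stretches provided by [near_limsup], the convolution with [q], which tends to
    [H], is close to [M] times the sum of [q]. *)
Lemma limsup_le : M * mu <= H.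
Proof.
pose c : R := `|M| + mu + B + 1.
have mu1 := tail_sum_ge1; have M0 := normr_ge0 M; have B0 := B_ge0.
have c0 : 0 < c by rewrite /c; lra.
apply/ler_addgt0Pr => eps' e'0.
pose eps := eps' / c; have e0 : 0 < eps by rewrite divr_gt0.
have eE : eps' = eps * c by rewrite /eps divfK // gt_eqF.
have [K0 HK] := cvgn_dist q_sum e0.
have [n1 Hn1] := cvgn_dist qu_cvg e0.
have [n nK un] := near_limsup K0 n1 e0.
have {HK} HK N : (K0 <= N)%N -> mu - eps <= \sum_(i < N) q i.
  by move=> /HK; rewrite /series /= big_mkord ler_norml => /andP[_]; lra.
have sum_q_le N : \sum_(i < N) q i <= mu.
  have qmu : limn (series q) = mu by apply: cvg_lim q_sum; exact: Rhausdorff.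
  rewrite -qmu; apply: limr_ge; first by apply/cvg_ex; exists mu.
  exists N => // m /= Nm; rewrite /series /= (big_cat_nat _ Nm) //= big_mkord.
  by rewrite lerDl; apply: sumr_ge0.
have := Hn1 n _; rewrite ler_norml => /(_ _)/andP[|+ _]; first by clear -nK; lia.
set T := \sum_(i < n.+1) _ => HT.
have Kn : (K0 <= n.+1)%N by clear -nK; lia.
have : (M - eps) * \sum_(i < K0) q i - B * (mu - \sum_(i < K0) q i) <= T.
  rewrite /T -(big_mkord predT (fun i => q i * u (n - i)%N)).
  rewrite (big_cat_nat _ Kn) //= big_mkord; apply: lerD.
    rewrite mulr_sumr; apply: ler_sum => i _.
    by rewrite mulrC ler_wpM2l // un.
  apply: (@le_trans _ _ (\sum_(K0 <= i < n.+1) q i * - B)).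
    rewrite -mulr_suml mulrN lerN2 mulrC ler_wpM2l //.
    have := sum_q_le n.+1; rewrite -(big_mkord predT q) (big_cat_nat _ Kn) //=.
    by rewrite big_mkord; lra.
  apply: ler_sum => i _; rewrite ler_wpM2l //.
  by have := u_bound (n - i)%N; rewrite ler_norml => /andP[].
set Q := \sum_(i < K0) q i => HT2.
have Q1 : mu - eps <= Q := HK K0 (leqnn _).
have Q2 : Q <= mu := sum_q_le K0.
have nM : - `|M| <= M <= `|M| by rewrite -ler_norml.
have : M * (mu - Q) <= `|M| * eps.
  apply: (@le_trans _ _ (`|M| * (mu - Q))); first by rewrite ler_wpM2r //; lra.
  by rewrite ler_wpM2l //; lra.
have : B * (mu - Q) <= B * eps by rewrite ler_wpM2l //; lra.
have : eps * Q <= eps * mu by rewrite ler_wpM2l // ltW.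
by rewrite eE /c; lra.
Qed.

Lemma eventually_le (eps : R) : 0 < eps ->
  exists n0, forall n, (n0 <= n)%N -> u n <= H / mu + eps.
Proof.
move=> /le_M[n0 Hn0]; exists n0 => n /Hn0 /le_trans; apply.
rewrite lerD2r ler_pdivlMr; first exact: limsup_le.
by have := tail_sum_ge1; lra.
Qed.

End LimSup.

(** The Erdos-Feller-Pollard theorem.  The bound on the limit superior, applied to [u] and
    to [- u], leaves only one possible limit point. *)
Theorem renewal_theorem (h u : nat -> R) (B H : R) :
  (forall n, `|u n| <= B) ->
  (forall n, u n.+1 = h n.+1 + \sum_(i < n.+1) p i * u (n - i)%N) ->
  h @ \oo --> (0 : R) ->
  (fun n => \sum_(i < n.+1) q i * u (n - i)%N) @ \oo --> H ->
  u @ \oo --> H / mu.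
Proof.
move=> uB urec h0 quH.
apply/cvgrPdist_le => eps e0.
have [n1 H1] := eventually_le uB urec h0 quH e0.
have [||||n2 H2] :=
  @eventually_le (fun n => - h n) (fun n => - u n) B (- H) _ _ _ _ eps e0.
- by move=> n; rewrite normrN.
- by move=> n; rewrite urec opprD -sumrN; congr +%R; apply: eq_bigr => i _; rewrite mulrN.
- by rewrite -[X in _ --> X]oppr0; exact: cvgN.
- rewrite (_ : (fun n => _) = (fun n => - \sum_(i < n.+1) q i * u (n - i)%N)).
    exact: cvgN.
  by apply/funext => n; rewrite -sumrN; apply: eq_bigr => i _; rewrite mulrN.
exists (n1 + n2)%N => // n /= n12.
have := H1 n; have := H2 n; rewrite ler_norml mulNr => A1 A2.
have {}A1 := A1 (leq_trans (leq_addl _ _) n12).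
have {}A2 := A2 (leq_trans (leq_addr _ _) n12).
by apply/andP; split; lra.
Qed.

End Renewal.

(** * From the renewal equation to the growth rate *)

Section Growth.

Lemma growth_limit (R : realType) (s w t : nat -> nat) (m k1 k2 : nat) :
  s 0%N = 1%N -> w 0%N = 1%N -> (0 < m)%N ->
  (forall n, s n.+1 + s n =
     w n.+1 + w n + m * \sum_(i < n.+1) t i * s (n - i))%N ->
  (forall i j, w (i + j) <= w i * w j)%N ->
  (forall i, 0 < t i)%N -> (forall i, t i <= w i)%N ->
  (forall i, w i <= t (k1 + i) + t (k2 + i))%N ->
  exists lambda C : R, [/\ 1 < lambda, 0 < C &
    (fun n => (s n)%:R / lambda ^+ n) @ \oo --> C].
Proof.
move=> s0 w0 m0 rec w_sub t0 tw wt.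
pose tR n : R := (t n)%:R; pose wR n : R := (w n)%:R; pose mR : R := m%:R.
have tR1 i : 1 <= tR i by rewrite ler1n.
have mR1 : 1 <= mR by rewrite ler1n.
have wR0 i : 0 <= wR i by rewrite ler0n.
have [x0 [x1 [B [/andP[x0_gt0 x0_lt1] x01 F_le1 B_le tight]]]] :
    exists x0 x1 B : R, [/\ 0 < x0 < 1, x0 < x1,
      forall N, psum (renewal_kernel tR mR) N x0 <= 1,
      forall N, psum (renewal_kernel tR mR) N x1 <= B /\ psum wR N x1 <= B &
      forall eta, 0 < eta -> exists N, 1 - eta < psum (renewal_kernel tR mR) N x0].
  apply: (@critical_radius _ wR tR mR k1 k2) => // [i j|i|i].
  - by rewrite /wR -natrM ler_nat.
  - by rewrite ler_nat.
  - by rewrite -natrD ler_nat.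
set F := renewal_kernel tR mR in F_le1 B_le tight.
have F_ge0 : forall k, 0 <= F k := renewal_kernel_ge0 tR1 mR1.
have x0_ge0 := ltW x0_gt0; have x1_gt0 : 0 < x1 by lra.
pose p k := F k.+1 * x0 ^+ k.+1.
have p_ge0 k : 0 <= p k by rewrite mulr_ge0 ?exprn_ge0.
have p_gt0 k : 0 < p k.+1.
  rewrite mulr_gt0 ?exprn_gt0 //.
  exact: lt_le_trans (renewal_kernel_gt0 tR1 mR1 k).
have psumE N : psum F N.+1 x0 = \sum_(i < N) p i.
  by rewrite /psum big_ord_recl mul0r add0r; apply: eq_bigr => i _; rewrite lift0.
pose q k := 1 - \sum_(i < k) p i.
have q0 : q 0%N = 1 by rewrite /q big_ord0 subr0.
have qS k : q k.+1 = q k - p k by rewrite /q big_ord_recr /=; ring.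
have q_ge0 k : 0 <= q k by rewrite subr_ge0 -psumE.
(* Convergence of [F] at [x1 > x0] makes the tails [q] decay like [(x0 / x1) ^ k], so the
   mean is finite. *)
pose rho := x0 / x1.
have rho0 : 0 < rho by rewrite divr_gt0.
have rho1 : rho < 1 by rewrite ltr_pdivrMr // mul1r.
have q_geo k : q k <= B * rho ^+ k.
  apply/ler_addgt0Pr => eta /tight[N FN].
  pose N1 := maxn k N.
  have : psum F N.+1 x0 <= 1 - q k + B * rho ^+ k.
    apply: (@le_trans _ _ (\sum_(i < N1) p i)).
      rewrite -psumE; apply: psum_leq => //.
      by rewrite ltnS leq_maxr.
    rewrite -(big_mkord predT p) (big_cat_nat _ (leq_maxl k N)) //= big_mkord.
    rewrite {1}/q opprB addrCA subrr addr0 lerD2l.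
    apply: (@le_trans _ _ (\sum_(k <= i < N1) F i.+1 * x1 ^+ i.+1 * rho ^+ k)).
      rewrite big_nat [leRHS]big_nat; apply: ler_sum => i /andP[ki _].
      rewrite /p -mulrA ler_wpM2l // -[x0](divfK (lt0r_neq0 x1_gt0)) -/rho.
      rewrite exprMn mulrC ler_wpM2l ?exprn_ge0 ?(ltW x1_gt0) //.
      by rewrite ler_wiXn2l ?(ltW rho0) ?(ltW rho1) // (leqW ki).
    rewrite -mulr_suml ler_wpM2r ?exprn_ge0 ?(ltW rho0) //.
    apply: le_trans (B_le N1.+1).1.
    rewrite /psum big_ord_recl mul0r add0r.
    rewrite -(big_mkord predT (fun i => F i.+1 * x1 ^+ i.+1)).
    rewrite [leRHS](big_cat_nat _ (leq_maxl k N)) //= lerDr.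
    apply: sumr_ge0 => i _; apply: mulr_ge0; first exact: (F_ge0 i.+1).
    by rewrite exprn_ge0 ?(ltW x1_gt0).
  have : psum F N x0 <= psum F N.+1 x0 by apply: psum_leq.
  lra.
have B0 : 0 <= B by have := (B_le 0%N).1; rewrite /psum big_ord0.
have [mu q_sum] : exists mu : R, series q @ \oo --> mu.
  have geo0 n : 0 <= geometric B rho n by rewrite mulr_ge0 ?exprn_ge0 // ltW.
  have geo_cvg : cvgn (series (geometric B rho)).
    by apply: is_cvg_geometric_series; rewrite ger0_norm // ltW.
  by exists (limn (series q)); exact: (series_le_cvg q_ge0 geo0 q_geo geo_cvg).
pose u n := (s n)%:R * x0 ^+ n.
pose h n := (if n is n'.+1 then wR n + wR n' else 1) * x0 ^+ n.
have u0 : u 0%N = 1 by rewrite /u s0 mulr1.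
have u_ge0 n : 0 <= u n by rewrite mulr_ge0 ?exprn_ge0.
have h_ge0 n : 0 <= h n.
  by rewrite mulr_ge0 ?exprn_ge0 //; case: n => // n; rewrite addr_ge0.
have u_rec n : u n.+1 = h n.+1 + \sum_(i < n.+1) p i * u (n - i)%N.
  have sR : (s n.+1)%:R =
      wR n.+1 + wR n + \sum_(i < n.+1) F i.+1 * (s (n - i)%N)%:R.
    have /(congr1 (fun k => k%:R : R)) := rec n.
    rewrite !natrD natrM natr_sum => E.
    rewrite (_ : \sum_(i < n.+1) _ =
      mR * \sum_(i < n.+1) (t i * s (n - i))%N%:R - (s n)%:R).
      by rewrite addrA -E addrK.
    rewrite mulr_sumr !big_ord_recl /F /= subn0 natrM /tR.
    rewrite (_ : \sum_(i < n) _ =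
      \sum_(i < n) mR * (t (bump 0 i) * s (n - bump 0 i))%N%:R); first by ring.
    by apply: eq_bigr => i _; rewrite natrM /bump /= subr0; ring.
  rewrite /u sR mulrDl mulr_suml; congr +%R; apply: eq_bigr => i _.
  rewrite /p mulrACA -exprD; congr (_ * _ ^+ _).
  by rewrite addSn subnKC // -ltnS.
(* Summation by parts: [1] minus the sum of the [p k * x ^ k.+1] is [1 - x] times the
   series of [q]. *)
have qu n : \sum_(i < n.+1) q i * u (n - i)%N = \sum_(i < n.+1) h i.
  elim: n => [|n IH].
    by rewrite !big_ord1 subn0 q0 u0 /h expr0 !mulr1.
  rewrite big_ord_recl q0 mul1r subn0 [RHS]big_ord_recr /= -IH u_rec.
  rewrite -addrA addrC; congr +%R; rewrite -big_split /=; apply: eq_bigr => i _.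
  by rewrite /bump add1n subSS qS; ring.
have w_le N : psum wR N x0 <= B.
  by apply: le_trans (B_le N).2; apply: psum_mono; rewrite // ltW.
have h_bound N : \sum_(i < N.+1) h i <= B + B.
  apply: le_trans (lerD (w_le N.+1) (w_le N)).
  elim: N => [|N IH]; first by rewrite /psum !big_ord1 big_ord0 addr0 /h /wR w0.
  rewrite big_ord_recr /= /psum [in leRHS]big_ord_recr [X in _ <= _ + X]big_ord_recr /=.
  rewrite addrACA; apply: lerD IH _; rewrite /h mulrDl lerD2l ler_wpM2l //.
  by rewrite exprS ler_piMl ?exprn_ge0 // ltW.
have sum_h_cvg : cvgn (series h).
  apply: nondecreasing_is_cvgn.
    by apply/nondecreasing_seqP => n; rewrite /series /= big_nat_recr //= lerDl.
  exists (B + B) => _ [n _ <-]; rewrite /series /= big_mkord.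
  apply: le_trans (h_bound n); rewrite big_ord_recr /= lerDl //.
pose H := limn (series h).
have sum_h : series h @ \oo --> H by [].
have H_gt0 : 0 < H.
  apply: (@lt_le_trans _ _ 1) => //; apply: limr_ge => //.
  exists 1%N => // n /= n1; rewrite /series /= big_ltn // {1}/h mulr1 lerDl.
  by apply: sumr_ge0.
have u_cvg : u @ \oo --> H / mu.
  apply: (renewal_theorem p_ge0 p_gt0 q0 qS q_ge0 q_sum (B := B + B) _ u_rec).
  - move=> n; rewrite ger0_norm //; apply: le_trans (h_bound n).
    rewrite -qu big_ord_recl q0 mul1r subn0 lerDl.
    by apply: sumr_ge0 => i _; rewrite mulr_ge0.
  - exact: cvg_series_cvg_0.
  - rewrite (_ : (fun n => _) = (fun n => series h n.+1)).
      by rewrite (cvg_shiftS (series h)).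
    by apply/funext => n; rewrite qu /series /= big_mkord.
have mu1 := tail_sum_ge1 q0 q_ge0 q_sum.
exists x0^-1, (H / mu); split; first by rewrite invf_gt1.
  by rewrite divr_gt0 //; lra.
rewrite (_ : (fun n => _) = u) //.
by apply/funext => n; rewrite /u exprVn invrK.
Qed.

End Growth.

(** * The action of the group on reduced words *)

Section WordProblem.
Local Open Scope nat_scope.
Local Open Scope seq_scope.

Variables (A : finType) (inv : A -> A) (c : rel A).
Implicit Types (a b : A) (w z : seq A).
Hypothesis c_irr : irreflexive c.
Hypothesis c_sym : symmetric c.
Hypothesis invK : involutive inv.
Hypothesis c_inv : forall a b, c a (inv b) = c a b.
Local Notation trace_eq := (trace_eq c).
Local Notation initial := (initial c).
Local Notation reduced := (reduced inv c).

Let teq_refl := trace_eq_refl c.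
Let teq_trans := @trace_eq_trans _ c.
Let teq_sym := @trace_eq_sym _ c.

(** Multiplication by a letter, carried out on reduced words. *)
Definition push a w := if initial (inv a) w then rem (inv a) w else a :: w.

Lemma trace_eq_rem a w z :
  initial a w -> trace_eq w z -> trace_eq (rem a w) (rem a z).
Proof.
move=> iw wz; have iz : initial a z by rewrite -(initial_trace_eq c_irr _ wz).
rewrite -(trace_eq_cons c a); apply: teq_trans (rem_initial c_irr c_sym iz).
by apply: teq_trans wz; rewrite teq_sym; exact: rem_initial.
Qed.

Lemma trace_eq_push a w z : trace_eq w z -> trace_eq (push a w) (push a z).
Proof.
move=> wz; rewrite /push -(initial_trace_eq c_irr _ wz).
by case: ifP => [iw|_]; [exact: trace_eq_rem | rewrite trace_eq_cons].
Qed.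

Lemma reduced_push a w : reduced w -> reduced (push a w).
Proof.
rewrite /push => rw; case: ifP => [iw|ni] /=; last by rewrite ni.
by have /andP[] := reduced_rem c_irr c_sym c_inv rw iw.
Qed.

Lemma push_reduced a w : ~~ initial (inv a) w -> push a w = a :: w.
Proof. by rewrite /push => /negPf ->. Qed.

Lemma push_inv a w : reduced w -> trace_eq (push (inv a) (push a w)) w.
Proof.
move=> rw; rewrite {2}/push; case: ifP => [iw|ni].
  have /andP[_ ni] := reduced_rem c_irr c_sym c_inv rw iw.
  by rewrite push_reduced // teq_sym; exact: rem_initial.
by rewrite /push invK /= eqxx.
Qed.

Lemma initial_push a b w : c a b -> initial a (push b w) = initial a w.
Proof.
move=> cab; have nab : a != inv b by apply: (c_neq c_irr); rewrite c_inv.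
rewrite /push; case: ifP => [iw|_].
  rewrite [RHS](initial_trace_eq c_irr _ (rem_initial c_irr c_sym iw)).
  by rewrite initial_cons_neq // c_inv cab.
by rewrite initial_cons_neq ?cab // (c_neq c_irr).
Qed.

(** Commuting letters do not influence whether the other one cancels
    ([initial_push]), so both orders perform the same two cancellations or insertions. *)
Lemma push_comm a b w : c a b -> trace_eq (push a (push b w)) (push b (push a w)).
Proof.
move=> cab; have cba : c b a by rewrite c_sym.
have c_invl := c_invl c_sym c_inv.
have ab : a != b := c_neq c_irr cab.
have nab : a != inv b by apply: (c_neq c_irr); rewrite c_inv.
have nba : b != inv a by apply: (c_neq c_irr); rewrite c_inv.
have iab : initial (inv a) (push b w) = initial (inv a) w.
  by apply: initial_push; rewrite c_invl.
have iba : initial (inv b) (push a w) = initial (inv b) w.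
  by apply: initial_push; rewrite c_invl.
rewrite {1}[push a (push b w)]/push {1}[push b (push a w)]/push iab iba.
rewrite /push; case: ifP => ia; case: ifP => ib.
- rewrite -(trace_eq_cons c (inv a)) -(trace_eq_cons c (inv b)).
  have R x u : initial x u -> trace_eq (x :: rem x u) u.
    by move=> ix; rewrite teq_sym; exact: rem_initial.
  have S x u : c x (inv b) -> trace_eq (inv b :: x :: u) (x :: inv b :: u).
    by move=> cx; apply: swap_trace_eq => //; rewrite c_sym.
  apply: (@teq_trans w); last first.
    rewrite teq_sym; apply: teq_trans (S _ _ _) _; first by rewrite c_inv c_invl.
    apply: (@teq_trans (inv a :: rem (inv a) w)); last exact: R.
    rewrite trace_eq_cons; apply: R.
    by move: iba; rewrite /push ia => ->.
  apply: (@teq_trans (inv b :: rem (inv b) w)); last exact: R.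
  rewrite trace_eq_cons; apply: R.
  by move: iab; rewrite /push ib => ->.
- by rewrite /= (negPf nba) teq_refl.
- by rewrite /= (negPf nab) teq_refl.
- exact: swap_trace_eq.
Qed.

Definition normalize w := foldr push [::] w.

Lemma reduced_pushes w z : reduced w -> reduced (foldr push w z).
Proof. by move=> rw; elim: z => //= a z; exact: reduced_push. Qed.

Lemma reduced_normalize w : reduced (normalize w).
Proof. exact: reduced_pushes. Qed.

Lemma size_normalize w : size (normalize w) <= size w.
Proof.
elim: w => //= a w IH; rewrite /push; case: ifP => [/initial_mem iw|_] //.
by rewrite size_rem // (leq_trans (leq_pred _)) // ltnW.
Qed.

Lemma normalize_id w : reduced w -> normalize w = w.
Proof. by elim: w => //= a w IH /andP[ni /IH ->]; rewrite push_reduced. Qed.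

Lemma trace_eq_pushes u w z : trace_eq w z ->
  trace_eq (foldr push w u) (foldr push z u).
Proof. by move=> wz; elim: u => //= a u; exact: trace_eq_push. Qed.

End WordProblem.

(** * Presented groups *)

Section PresentedGroups.
Local Open Scope group_scope.

Variable V : finType.
Implicit Types (rels : set (word V)) (u v : word V) (x y : V).

Lemma pres_eq_cons rels (a : letter V) u v :
  pres_eq rels u v -> pres_eq rels (a :: u) (a :: v).
Proof.
by move=> uv; apply: (@pres_eq_cat _ _ [:: a] [:: a]) => //; exact: pres_eq_refl.
Qed.

Lemma pres_class_cons rels b x u : pres_class rels ((x, b) :: u) =
  (if b then pres_gen rels x else (pres_gen rels x)^-1) * pres_class rels u.
Proof.
rewrite -[(x, b) :: u]cat1s -pres_mulE; congr (_ * _).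
by case: b => //; exact: esym (pres_invE rels [:: (x, true)]).
Qed.

Lemma pres_class_nil rels : pres_class rels [::] = 1 :> presented rels.
Proof. by []. Qed.

Lemma pres_letter rels (x : V) b : pres_class rels [:: (x, b)] =
  if b then pres_gen rels x else (pres_gen rels x)^-1.
Proof. by rewrite pres_class_cons pres_class_nil mulg1. Qed.

Lemma presented_ind rels (P : presented rels -> Prop) : P 1 ->
  (forall x g, P g -> P (pres_gen rels x * g)) ->
  (forall x g, P g -> P ((pres_gen rels x)^-1 * g)) -> forall g, P g.
Proof.
move=> P1 PM PV g; rewrite -(pres_reprK g).
elim: (pres_repr g) => [//|[x b] u IH]; rewrite pres_class_cons.
by case: b; [exact: PM | exact: PV].
Qed.

Lemma comm_relator rels x y : rels (comm_word x y) ->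
  commute (pres_gen rels x) (pres_gen rels y).
Proof.
move=> r; have /pres_classP := pres_eq_rel r.
rewrite !pres_class_cons pres_class_nil mulg1 => E.
apply: (can_inj (mulKg (pres_gen rels y)^-1)).
by apply: (can_inj (mulKg (pres_gen rels x)^-1)); rewrite E mulKg mulVg.
Qed.

Lemma comm_letters rels (a b : letter V) : rels (comm_word a.1 b.1) ->
  pres_eq rels [:: a; b] [:: b; a].
Proof.
move=> /comm_relator; case: a b => [x s] [y s'] /= xy; apply/pres_classP.
rewrite !pres_class_cons pres_class_nil !mulg1.
have VC (G : groupType) (g h : G) : commute g h -> commute g^-1 h.
  by move=> gh; apply/commute_sym/commuteV/commute_sym.
by case: s; case: s'; [| exact: commuteV | exact: VC | exact/VC/commuteV].
Qed.

Lemma product_of_lengthP rels (g : presented rels) n :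
  is_product_of_length (std_gens rels) g n <->
  exists2 u : word V, size u = n & g = pres_class rels u.
Proof.
split=> [[s [<- sS ->]]|[u <- ->]].
  elim: s sS => [|x s IH] sS; first by exists [::]; rewrite ?big_nil.
  have [|u su us] := IH; first by move=> y ys; apply: sS; rewrite inE ys orbT.
  have [|v xv] := sS x; first by rewrite inE eqxx.
  have [b xb] : exists b, x = if b then pres_gen rels v else (pres_gen rels v)^-1%g.
    by case: xv => ->; [exists true | exists false].
  by exists ((v, b) :: u); rewrite /= ?su // pres_class_cons big_cons us xb.
elim: u => [|[v b] u [s [su sS us]]]; first by exists [::]; split; rewrite ?big_nil.
exists ((if b then pres_gen rels v else (pres_gen rels v)^-1%g) :: s); split.
- by rewrite /= su.
- move=> x; rewrite inE => /orP[/eqP->|/sS //].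
  by exists v; case: b; [left|right].
- by rewrite big_cons pres_class_cons us.
Qed.

End PresentedGroups.

(** * Spheres of a presented group as sets of traces *)

Section Presentation.
Local Open Scope nat_scope.
Local Open Scope seq_scope.

Variables (A : finType) (inv : A -> A) (c : rel A).
Hypothesis c_irr : irreflexive c.
Hypothesis c_sym : symmetric c.
Hypothesis invK : involutive inv.
Hypothesis c_inv : forall a b, c a (inv b) = c a b.
Variables (V : finType) (rels : set (word V)).
Variables (phi : letter V -> A) (psi : A -> letter V).
(* [phi] may identify [v] with [v^-1], as it does for Coxeter groups. *)
Hypothesis phiK : cancel psi phi.
Hypothesis psi_phi : forall x, pres_eq rels [:: x] [:: psi (phi x)].
Hypothesis psi_comm : forall a b, c a b ->
  pres_eq rels [:: psi a; psi b] [:: psi b; psi a].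
Hypothesis phi_inv : forall x, phi (letter_inv x) = inv (phi x).
Hypothesis rels_push : forall r, rels r -> forall w, reduced inv c w ->
  trace_eq c (foldr (push inv c) w (map phi r)) w.

(** The relators act trivially on reduced words up to commutation, so the group acts: words
    equal in the group have the same effect.  Acting on the empty word shows that equal
    elements have equal normal forms. *)
Lemma pres_eq_push u v : pres_eq rels u v -> forall w, reduced inv c w ->
  trace_eq c (foldr (push inv c) w (map phi u)) (foldr (push inv c) w (map phi v)).
Proof.
elim=> {u v} [u|u v _ IH|u v y _ IH1 _ IH2|u u' v v' _ IH1 _ IH2|x|r rr] w rw.
- exact: trace_eq_refl.
- by rewrite trace_eq_sym; exact: IH.
- by apply: trace_eq_trans (IH1 _ rw) (IH2 _ rw).
- rewrite !map_cat !foldr_cat.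
  apply: trace_eq_trans (IH1 _ (reduced_pushes c_irr c_sym c_inv _ rw)) _.
  exact: trace_eq_pushes (IH2 _ rw).
- rewrite /= phi_inv -{1}[phi x]invK; exact: push_inv.
- exact: rels_push.
Qed.

Lemma pres_eq_rem a w : initial c a w ->
  pres_eq rels (map psi w) (psi a :: map psi (rem a w)).
Proof.
elim: w => //= x w IH; case: eqVneq => [->|xa] /=; first by move=> _; exact: pres_eq_refl.
case/andP => cax /IH iw.
apply: pres_eq_trans (pres_eq_cons _ iw) _.
apply: (@pres_eq_cat _ _ [:: psi x; psi a] [:: psi a; psi x]); last exact: pres_eq_refl.
by apply: psi_comm; rewrite c_sym.
Qed.

Lemma trace_eq_pres w z : trace_eq c w z -> pres_eq rels (map psi w) (map psi z).
Proof.
elim: w z => [|a w IH] z wz.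
  by move: (trace_eq_size c_irr wz); case: z {wz} => // _; exact: pres_eq_refl.
have iz : initial c a z by rewrite -(initial_trace_eq c_irr _ wz) /= eqxx.
apply: pres_eq_trans (pres_eq_sym (pres_eq_rem iz)) => /=.
apply/pres_eq_cons/IH; rewrite -(trace_eq_cons c a).
by apply: trace_eq_trans wz _; exact: rem_initial.
Qed.

Lemma psi_inv a : pres_eq rels [:: psi a; psi (inv a)] [::].
Proof.
apply: pres_eq_trans (pres_eq_cancel rels (psi a)); apply: pres_eq_cons.
apply: pres_eq_sym; apply: pres_eq_trans (psi_phi _) _.
by rewrite phi_inv phiK; exact: pres_eq_refl.
Qed.

Lemma pres_push a w : pres_eq rels (map psi (push inv c a w)) (psi a :: map psi w).
Proof.
rewrite /push; case: ifP => [iw|_] /=; last exact: pres_eq_refl.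
apply: pres_eq_sym; apply: pres_eq_trans (pres_eq_cons _ (pres_eq_rem iw)) _.
apply: (@pres_eq_cat _ _ [:: psi a; psi (inv a)] [::]); last exact: pres_eq_refl.
exact: psi_inv.
Qed.

Lemma pres_normalize u : pres_eq rels (map psi (normalize inv c (map phi u))) u.
Proof.
elim: u => [|x u IH] /=; first exact: pres_eq_refl.
apply: pres_eq_trans (pres_push _ _) _.
apply: (@pres_eq_cat _ _ [:: psi (phi x)] [:: x]) => //.
exact/pres_eq_sym/psi_phi.
Qed.

Let normal_form (u : word V) := normalize inv c (map phi u).

Lemma pres_eq_normal_form u v : pres_eq rels u v ->
  trace_eq c (normal_form u) (normal_form v).
Proof. by move=> uv; exact: pres_eq_push. Qed.

(** Normalizing does not lengthen a word and depends, up to commutation, only on the group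
    element; so the normal form is a shortest word. *)
Lemma sphereP (g : presented rels) n : sphere (std_gens rels) n g <->
  size (normal_form (pres_repr g)) = n.
Proof.
have gE : g = pres_class rels (map psi (normal_form (pres_repr g))).
  rewrite -[LHS]pres_reprK; apply/pres_classP/pres_eq_sym; exact: pres_normalize.
have le u : g = pres_class rels u -> size (normal_form (pres_repr g)) <= size u.
  move=> gu; have /pres_eq_normal_form/(trace_eq_size c_irr) -> :
      pres_eq rels (pres_repr g) u by apply/pres_classP; rewrite pres_reprK.
  by rewrite (leq_trans (size_normalize _ _ _)) ?size_map.
split=> [[/product_of_lengthP[u <- gu] min]|<-].
  apply/eqP; rewrite eqn_leq le //=; apply: min.
  apply/product_of_lengthP; exists (map psi (normal_form (pres_repr g))) => //.
  by rewrite size_map.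
split=> [|k /product_of_lengthP[u <- gu]]; last exact: le.
apply/product_of_lengthP; exists (map psi (normal_form (pres_repr g))) => //.
by rewrite size_map.
Qed.

Lemma card_sphere n : #|` fset_set (sphere (std_gens rels) n)|%fset =
  num_avoid inv c (finset.setT : {set A}) finset.set0 n.
Proof.
pose f (w : seq A) := pres_class rels (map psi w).
have nfK w : reduced inv c w -> normalize inv c (map phi (map psi w)) = w.
  move=> rw; rewrite -map_comp (eq_map phiK) map_id.
  exact: normalize_id.
have redE w : red_avoid inv c finset.setT finset.set0 w = reduced inv c w.
  rewrite red_avoid0; have -> // : all (mem (finset.setTfor A)) w.
  by apply/allP => x _; rewrite /= finset.in_setT.
pose L := map f (nf_words c n (red_avoid inv c finset.setT finset.set0)).
have LE : sphere (std_gens rels) n = [set g | g \in seq_fset tt L].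
  have LE' g : [set g | g \in seq_fset tt L] g = (g \in L) :> Prop.
    by rewrite -(seq_fsetE tt L).
  apply/seteqP; split=> g; rewrite sphereP LE'.
    move=> sg; pose w := normal_form (pres_repr g).
    have rw : reduced inv c (trace_nf c w).
      rewrite -(reduced_trace_eq c_irr c_sym c_inv (trace_nf_eq _ w)).
      exact: reduced_normalize.
    apply/mapP; exists (trace_nf c w).
      by rewrite mem_nf_words size_trace_nf // sg eqxx redE rw trace_nfK eqxx.
    rewrite /f -[LHS]pres_reprK; apply/pres_classP.
    apply: pres_eq_trans (pres_eq_sym (pres_normalize _)) _.
    exact/trace_eq_pres/trace_nf_eq.
  case/mapP => w; rewrite mem_nf_words redE => /and3P[/eqP sw rw _] ->.
  have /pres_eq_normal_form/(trace_eq_size c_irr) -> := pres_repr_class rels (map psi w).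
  by rewrite /normal_form nfK.
rewrite LE set_fsetK size_seq_fset undup_id ?size_map //.
rewrite map_inj_in_uniq ?nf_words_uniq // => w z.
rewrite !mem_nf_words !redE => /and3P[_ rw /eqP ew] /and3P[_ rz /eqP ez].
move=> /pres_classP/pres_eq_normal_form; rewrite /normal_form !nfK //.
by rewrite -eq_trace_nf ew ez => /eqP.
Qed.

End Presentation.

(** * Virtually cyclic groups and direct products *)

Section Splittings.
Local Open Scope group_scope.

Variable V : finType.
Implicit Types (rels : set (word V)) (u v : word V) (x y : V) (B : pred V).

Lemma cyclic_mul (G : groupType) (g h : G) :
  cyclic_subgroup g h -> cyclic_subgroup g (g * h) /\ cyclic_subgroup g (g^-1 * h).
Proof.
move=> [n [->|->]]; split.
- by exists n.+1; left; rewrite expgS.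
- case: n => [|n]; first by exists 1%N; right; rewrite mulg1.
  by exists n; left; rewrite expgS mulKg.
- case: n => [|n]; first by exists 1%N; left; rewrite invg1 mulg1.
  by exists n; right; rewrite expgSr invgM mulVKg.
- by exists n.+1; right; rewrite expgSr invgM.
Qed.

Lemma cyclic1 (G : groupType) (g : G) : cyclic_subgroup g 1.
Proof. by exists 0%N; left. Qed.

Lemma virtually_cyclic_le1 rels : (forall x y : V, x = y) ->
  virtually_cyclic (presented rels).
Proof.
move=> V1; pose g : presented rels :=
  if [pick x : V] is Some x then pres_gen rels x else 1.
exists g, [:: 1] => h; exists 1; rewrite ?inE // invg1 mulg1.
have gE x : pres_gen rels x = g.
  by rewrite /g; case: pickP => [y _|/(_ x)//]; rewrite (V1 x y).
elim/presented_ind: h => [|x h|x h]; first exact: cyclic1.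
  by rewrite gE => /cyclic_mul[].
by rewrite gE => /cyclic_mul[].
Qed.

(** The group is a quotient of the infinite dihedral group: conjugation by the involution
    [s] inverts [s * r], whose powers form a subgroup of index at most 2. *)
Lemma virtually_cyclic_dihedral rels (x y : V) :
  (forall z, z = x \/ z = y) ->
  (forall z, pres_gen rels z * pres_gen rels z = 1) ->
  virtually_cyclic (presented rels).
Proof.
move=> Vxy sq; set s := pres_gen rels x; set r := pres_gen rels y.
have s2 : s * s = 1 := sq x; have r2 : r * r = 1 := sq y.
have sV : s^-1 = s by apply: (can_inj (mulKg s)); rewrite mulgV s2.
have rV : r^-1 = r by apply: (can_inj (mulKg r)); rewrite mulgV r2.
pose g := s * r; have gs : s * g * s = g^-1.
  by rewrite /g mulgA s2 mul1g invgM sV rV.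
exists g; exists [:: 1; s] => h.
pose D (h : presented rels) := cyclic_subgroup g h \/ cyclic_subgroup g (h * s).
have flip k : cyclic_subgroup g k -> cyclic_subgroup g (s * k * s).
  have -> : s * k * s = k ^ s by rewrite conjgE sV mulgA.
  have gJ : g ^ s = g^-1 by rewrite conjgE sV mulgA gs.
  move=> [n [->|->]]; exists n.
    by right; rewrite conjXg gJ expVgn.
  by left; rewrite conjVg conjXg gJ expVgn invgK.
have Ds k : D k -> D (s * k).
  case=> [/flip|Dk]; first by right.
  by left; have := flip _ Dk; rewrite -!mulgA s2 mulg1.
have Dg k : D k -> D (g^-1 * k).
  by case=> /cyclic_mul[_]; [left|right; rewrite -mulgA].
have Dz z k : D k -> D (pres_gen rels z * k).
  have [->|->] := Vxy z; first exact: Ds.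
  have -> : pres_gen rels y * k = g^-1 * (s * k).
    by rewrite /g invgM sV rV -mulgA [s * (s * k)]mulgA s2 mul1g.
  by move=> /Ds/Dg.
have {Dz} : D h.
  elim/presented_ind: h => [|z k|z k]; first by left; exact: cyclic1.
    exact: Dz.
  have -> : (pres_gen rels z)^-1 = pres_gen rels z.
    by apply: (can_inj (mulKg (pres_gen rels z))); rewrite mulgV sq.
  exact: Dz.
case=> Dh; [exists 1 | exists s]; rewrite ?inE ?eqxx ?orbT //.
  by rewrite invg1 mulg1.
by rewrite sV.
Qed.

Section Join.
Variables (e : rel V) (rels : set (word V)).
Hypothesis rels_comm : forall x y, e x y -> rels (comm_word x y).
Hypothesis rels_form : forall r, rels r ->
  (exists x y, r = comm_word x y) \/ (exists x, r = [:: (x, true); (x, true)]).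

Definition kill (B : pred V) : set (word V) :=
  rels `|` [set r | exists2 x, ~~ B x & r = [:: (x, true)]].

Definition restrict (B : pred V) u := [seq a <- u | B a.1].

Lemma pres_eq_kill B u v : pres_eq rels u v -> pres_eq (kill B) u v.
Proof.
elim=> {u v} *; [exact: pres_eq_refl | exact: pres_eq_sym
  | by apply: pres_eq_trans; eassumption | exact: pres_eq_cat
  | exact: pres_eq_cancel |].
by apply: pres_eq_rel; left.
Qed.

(** Erasing the letters outside [B] turns each relator of the quotient into a consequence
    of the relators of the group, so the quotient embeds as the subgroup generated by
    [B]. *)
Lemma pres_eq_restrict B u v : pres_eq (kill B) u v ->
  pres_eq rels (restrict B u) (restrict B v).
Proof.
elim=> {u v} [u|u v _ IH|u v w _ IH1 _ IH2|u u' v v' _ IH1 _ IH2|a|r].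
- exact: pres_eq_refl.
- exact: pres_eq_sym.
- exact: pres_eq_trans IH1 IH2.
- by rewrite /restrict !filter_cat; exact: pres_eq_cat.
- rewrite /restrict /=; case: (B a.1); [exact: pres_eq_cancel | exact: pres_eq_refl].
case=> [rr|[x nBx ->]]; last by rewrite /restrict /= (negPf nBx); exact: pres_eq_refl.
have [[x [y rE]]|[x rE]] := rels_form rr; rewrite rE /restrict /=.
  case: (B x); case: (B y); last exact: pres_eq_refl.
  - by rewrite -/(comm_word x y) -rE; exact: pres_eq_rel.
  - exact: (pres_eq_cancel rels (x, false)).
  - exact: (pres_eq_cancel rels (y, false)).
by case: (B x); [rewrite -rE; exact: pres_eq_rel | exact: pres_eq_refl].
Qed.

Lemma restrict_eq B u : pres_eq (kill B) (restrict B u) u.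
Proof.
elim: u => [|[x b] u IH] /=; first exact: pres_eq_refl.
case: ifP => [_|/negbT nBx]; first exact: pres_eq_cons.
apply: pres_eq_trans IH _; apply: pres_eq_sym.
apply: (@pres_eq_cat _ _ [:: (x, b)] [::]); last exact: pres_eq_refl.
have g1 : pres_gen (kill B) x = 1.
  by apply/pres_classP/pres_eq_rel; right; exists x.
by apply/pres_classP; rewrite pres_letter g1; case: b; rewrite ?invg1.
Qed.

(** Every relator contains an even number of letters of a vertex that is not killed. *)
Lemma restrict_parity B u v x : B x -> pres_eq (kill B) u v ->
  odd (count (fun a => a.1 == x) u) = odd (count (fun a => a.1 == x) v).
Proof.
move=> Bx; elim=> {u v} [//|u v _ ->//|u v w _ -> _ ->//|u u' v v' _ IH1 _ IH2|a|r].
- by rewrite !count_cat !oddD IH1 IH2.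
- by rewrite /= addn0; case: eqP.
case=> [/rels_form[[y [z ->]]|[y ->]]|[y nBy ->]] /=.
- by case: eqP; case: eqP.
- by case: eqP.
- by case: eqP nBy => // ->; rewrite Bx.
Qed.

Lemma kill_nontrivial B x : B x -> nontrivial (presented (kill B)).
Proof.
move=> Bx; exists (pres_gen (kill B) x) => /pres_classP/(restrict_parity Bx) /=.
by rewrite eqxx.
Qed.

Variable B : pred V.
Hypothesis B_join : forall x y, B x -> ~~ B y -> e x y.
Let C : pred V := fun x => ~~ B x.

(** Letters of [C] move to the right across those of [B]. *)
Lemma pres_eq_sort u : pres_eq rels u (restrict B u ++ restrict C u).
Proof.
elim: u => [|a u IH] /=; first exact: pres_eq_refl.
rewrite /C; case: ifP => Ba /=; first exact: pres_eq_cons.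
apply: pres_eq_trans (pres_eq_cons a IH) _.
rewrite -cat_cons -[a :: restrict C u]cat1s catA; apply: pres_eq_cat (pres_eq_refl _ _).
elim: {IH} u => [|b u IH] /=; first exact: pres_eq_refl.
case: ifP => // Bb; apply: pres_eq_trans (pres_eq_cons b IH).
apply: (@pres_eq_cat _ _ [:: a; b] [:: b; a]); last exact: pres_eq_refl.
by apply/pres_eq_sym/comm_letters/rels_comm/B_join; rewrite ?Bb ?Ba.
Qed.

Definition join_map (g : presented rels) : presented (kill B) * presented (kill C) :=
  (pres_class (kill B) (pres_repr g), pres_class (kill C) (pres_repr g)).

Lemma join_mapE u : join_map (pres_class rels u) =
  (pres_class (kill B) u, pres_class (kill C) u).
Proof.
by congr pair; apply/pres_classP/pres_eq_kill/pres_repr_class.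
Qed.

Lemma join_mapM : {morph join_map : g h / g * h}.
Proof.
move=> g h; rewrite -(pres_reprK g) -(pres_reprK h).
rewrite [_ * _ in LHS](pres_mulE rels) !join_mapE.
by congr pair; rewrite -pres_mulE.
Qed.

Lemma join_map_inj : injective join_map.
Proof.
move=> g h /pair_equal_spec[/pres_classP Bgh /pres_classP Cgh].
move/pres_eq_restrict: Bgh => Bgh; move/pres_eq_restrict: Cgh => Cgh.
rewrite -(pres_reprK g) -(pres_reprK h); apply/pres_classP.
apply: pres_eq_trans (pres_eq_sort _) _; apply: pres_eq_sym.
apply: pres_eq_trans (pres_eq_sort _) _; apply: pres_eq_sym.
exact: pres_eq_cat.
Qed.

(** A preimage of a pair is the product of its components, each restricted to its own
    letters. *)
Lemma join_map_bij : bijective join_map.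
Proof.
pose f (p : presented (kill B) * presented (kill C)) :=
  pres_class rels (restrict B (pres_repr p.1) ++ restrict C (pres_repr p.2)).
have fK : cancel f join_map.
  case=> g h; rewrite /f join_mapE /=.
  have idem (P Q : pred V) w : restrict P (restrict Q w) =
    [seq a <- w | P a.1 && Q a.1] by rewrite /restrict -filter_predI.
  congr pair; [rewrite -[RHS](pres_reprK g) | rewrite -[RHS](pres_reprK h)];
    apply/pres_classP.
    apply: pres_eq_trans (restrict_eq B _).
    apply: pres_eq_trans (pres_eq_sym (restrict_eq B _)) _.
    rewrite {1}/restrict filter_cat -!/(restrict _ _) !idem.
    rewrite (@eq_filter _ (fun a => B a.1 && C a.1) pred0);
      last by move=> a; rewrite /C andbN.
    rewrite filter_pred0 cats0 (eq_filter (a2 := fun a => B a.1));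
      last by move=> a; rewrite andbb.
    exact: pres_eq_refl.
  apply: pres_eq_trans (restrict_eq C _).
  apply: pres_eq_trans (pres_eq_sym (restrict_eq C _)) _.
  rewrite {1}/restrict filter_cat -!/(restrict _ _) !idem.
  rewrite (@eq_filter _ (fun a => C a.1 && B a.1) pred0);
    last by move=> a; rewrite /C andNb.
  rewrite filter_pred0 cat0s (eq_filter (a2 := fun a => C a.1));
    last by move=> a; rewrite andbb.
  exact: pres_eq_refl.
by exists f => // g; apply: join_map_inj; rewrite fK.
Qed.

Lemma join_splits x y : B x -> ~~ B y -> splits_as_product (presented rels).
Proof.
move=> Bx By.
pose f : {multiplicative presented rels ->
           (presented (kill B) * presented (kill C))%type} :=
  HB.pack join_map (isMultiplicative.Build _ _ join_map join_mapM).
exists (presented (kill B)), (presented (kill C)), f.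
split; [exact: kill_nontrivial Bx | exact: kill_nontrivial By | exact: join_map_bij].
Qed.

End Join.

End Splittings.

(** * Growth of a partially commutative alphabet *)

Section TraceGrowth.
Variables (A : finType) (inv : A -> A) (c : rel A).
Hypothesis c_irr : irreflexive c.
Hypothesis c_sym : symmetric c.
Hypothesis invK : involutive inv.
Hypothesis c_inv : forall a b, c a (inv b) = c a b.

Lemma trace_growth (R : realType) (v x1 x2 b : A) (p1 p2 : seq A) :
  let other y := (y != v) && (y != inv v) in
  let covers x p := forall y, other y -> has (fun z => ~~ c y z) (x :: p) in
  path (linked inv c) x1 p1 -> path (linked inv c) x2 p2 ->
  all other (x1 :: p1) -> all other (x2 :: p2) ->
  covers x1 p1 -> covers x2 p2 -> ~~ c x1 v -> ~~ c x2 v ->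
  last x1 p1 != last x2 p2 -> ~~ c (last x1 p1) (last x2 p2) ->
  other b -> linked inv c x1 b ->
  exists lambda C : R, [/\ 1 < lambda, 0 < C &
    (fun n => (num_avoid inv c finset.setT finset.set0 n)%:R / lambda ^+ n) @ \oo --> C].
Proof.
move=> other covers P1 P2 O1 O2 C1 C2 v1 v2 l12 nc12 ob x1b.
pose W := (~: [set v; inv v])%SET; pose K := link c W v.
have memW y : (y \in W) = other y by rewrite !finset.inE negb_or.
have O1' y : y \in x1 :: p1 -> y \in W by move/(allP O1); rewrite memW.
have O2' y : y \in x2 :: p2 -> y \in W by move/(allP O2); rewrite memW.
have x1K : x1 \notin K by rewrite finset.inE negb_and v1 orbT.
have x2K : x2 \notin K by rewrite finset.inE negb_and v2 orbT.
apply: (@growth_limit R _ (num_avoid inv c W finset.set0) (num_avoid inv c W K)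
  #|[set v; inv v]%SET| (size p1).+1 (size p2).+1).
- exact: num_avoid0.
- exact: num_avoid0.
- by rewrite finset.cards2.
- exact: vertex_renewal.
- exact: num_avoid_submul.
- move=> i; apply: (@num_avoid_gt0 _ _ _ _ _ _ _ _ _ x1 b) => //.
    exact/O1'/mem_head.
  by rewrite memW.
- by move=> i; exact: num_avoid_le.
- move=> i; apply: (num_avoid_two_walks c_irr c_sym invK c_inv i _ P1 P2) => //.
  + by apply/fintype.subsetP => y; rewrite finset.inE => /andP[].
  + by move=> y; rewrite memW; exact: C1.
  + by move=> y; rewrite memW; exact: C2.
Qed.

End TraceGrowth.

(** * Walks in the graph of noncommuting vertices *)

Section Walks.
Local Open Scope nat_scope.
Variables (V : finType) (d : rel V).
Hypothesis d_sym : symmetric d.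
Hypothesis d_conn : forall x y, connect d x y.

Lemma covering_walk x : exists2 p, path d x p & forall y, y \in x :: p.
Proof.
suff [p dp sp] : exists2 p, path d x p & {subset enum V <= x :: p}.
  by exists p => // y; apply: sp; rewrite mem_enum.
elim: (enum V) => [|y s [p dp sp]]; first by exists [::].
have /connectP[q dq yE] := d_conn (last x p) y.
exists (p ++ q); first by rewrite cat_path dp.
move=> z; rewrite -cat_cons mem_cat inE => /orP[/eqP->|/sp-> //]; rewrite yE.
by have := mem_last (last x p) q; rewrite inE => /predU1P[->|->];
  rewrite ?mem_last ?orbT.
Qed.

(** Cut a covering walk at the moment when it meets the last new vertex [v]: what precedes
    it covers all other vertices, avoids [v] and ends at a neighbour of [v].  The walk
    is then reversed to start there. *)
Lemma walk_around_vertex : (exists x y : V, x != y) ->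
  exists v x p, [/\ path d x p, d v x, v \notin x :: p &
    forall y, y != v -> y \in x :: p].
Proof.
move=> [x0 [y0 xy0]]; have [p] := covering_walk x0.
elim/last_ind: p => [|p v IH] dp cov.
  by have := cov y0; rewrite inE eq_sym (negPf xy0).
rewrite rcons_path in dp; case/andP: dp => dp dv.
have [vp|vp] := boolP (v \in x0 :: p).
  by apply: IH => // y; have := cov y; 
    rewrite -rcons_cons mem_rcons inE => /orP[/eqP->|].
have revE : last x0 p :: rev (belast x0 p) = rev (x0 :: p).
  by rewrite [in RHS]lastI rev_rcons.
exists v, (last x0 p), (rev (belast x0 p)); split.
- by rewrite rev_path; rewrite (eq_path (e' := d)) // => x y; rewrite d_sym.
- by rewrite d_sym.
- by rewrite revE mem_rev.
- move=> y yv; rewrite revE mem_rev; have := cov y.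
  by rewrite -rcons_cons mem_rcons inE (negPf yv).
Qed.

End Walks.

(** * Right-angled Artin and Coxeter groups *)

Section ArtinCoxeter.

Variables (V : finType) (e : rel V).
Hypothesis e_sym : symmetric e.
Hypothesis e_irr : irreflexive e.

Definition noncommuting : rel V := fun x y => (x != y) && ~~ e x y.

Lemma noncommuting_sym : symmetric noncommuting.
Proof. by move=> x y; rewrite /noncommuting eq_sym e_sym. Qed.

(** The vertices of a component commute with all the vertices outside it, so a proper
    component would split the group. *)
Lemma noncommuting_connected (rels : set (word V)) :
  (forall x y, e x y -> rels (comm_word x y)) ->
  (forall r, rels r -> (exists x y, r = comm_word x y) \/
     (exists x, r = [:: (x, true); (x, true)])) ->
  ~ splits_as_product (presented rels) ->
  forall x y, connect noncommuting x y.
Proof.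
move=> rc rf nsplit x y; apply: contra_notT nsplit => nxy.
have B_join u w : connect noncommuting x u -> ~~ connect noncommuting x w -> e u w.
  move=> xu; apply: contraNT => nuw; have [<-//|uw] := eqVneq u w.
  by apply: connect_trans xu (connect1 _); rewrite /noncommuting uw.
exact: (join_splits rc rf B_join (connect0 _ _) nxy).
Qed.

Lemma push_commutator (A : finType) (inv : A -> A) (c : rel A)
  (c_irr : irreflexive c) (c_sym : symmetric c) (invK : involutive inv)
  (c_inv : forall a b, c a (inv b) = c a b) (a b : A) (w : seq A) :
  c a b -> reduced inv c w ->
  trace_eq c (foldr (push inv c) w [:: inv a; inv b; a; b]) w.
Proof.
move=> cab rw /=; have rp x z := @reduced_push _ _ _ c_irr c_sym c_inv x z.
apply: trace_eq_trans (push_inv c_irr c_sym invK c_inv a rw).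
apply: trace_eq_push => //.
apply: trace_eq_trans (push_inv c_irr c_sym invK c_inv b (rp a _ rw)).
by apply: trace_eq_push => //; exact: push_comm.
Qed.

Let letter_comm (a b : letter V) := e a.1 b.1.

Lemma card_sphere_raag n :
  #|` fset_set (sphere (std_gens (raag_relators e)) n)|%fset =
  num_avoid (@letter_inv V) letter_comm finset.setT finset.set0 n.
Proof.
have cirr : irreflexive letter_comm by move=> a; exact: e_irr.
have csym : symmetric letter_comm by move=> a b; exact: e_sym.
apply: (@card_sphere _ _ _ cirr csym (@letter_invK V) _ _ _ id id) => //.
- by move=> x; exact: pres_eq_refl.
- by move=> a b ab; apply: comm_letters; exists a.1, b.1.
- move=> _ [x [y [xy ->]]] w rw; rewrite map_id.
  exact: (push_commutator cirr csym (@letter_invK V) _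
            (a := (x, true)) (b := (y, true))).
Qed.

Lemma card_sphere_racg n :
  #|` fset_set (sphere (std_gens (racg_relators e)) n)|%fset =
  num_avoid id e finset.setT finset.set0 n.
Proof.
have idK : involutive (@id V) by [].
have sq x : pres_eq (racg_relators e) [:: (x, true); (x, true)] [::].
  by apply: pres_eq_rel; right; exists x.
apply: (@card_sphere _ _ _ e_irr e_sym idK _ _ _ fst (fun x => (x, true))) => //.
- case=> x [] /=; first exact: pres_eq_refl.
  apply: pres_eq_sym.
  apply: (@pres_eq_trans _ _ _ ([:: (x, true)] ++ [:: (x, true); (x, false)])).
    rewrite -[X in pres_eq _ X]cats0; apply: pres_eq_cat; first exact: pres_eq_refl.
    exact/pres_eq_sym/(pres_eq_cancel _ (x, true)).
  exact: (pres_eq_cat (sq x) (pres_eq_refl _ [:: (x, false)])).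
- by move=> x y xy; apply: comm_letters; left; exists x, y.
- move=> r [[x [y [xy ->]]]|[x ->]] w rw /=.
    exact: (push_commutator e_irr e_sym idK _ (a := x) (b := y)).
  exact: (push_inv e_irr e_sym idK).
Qed.

Section Growth.
Variable R : realType.
Hypothesis conn : forall x y, connect noncommuting x y.

(** The two walks run through the same vertices, one by the generators and the other by
    their inverses; so their last letters are inverse to each other. *)
Lemma raag_growth : (exists x y : V, x != y) ->
  exists lambda C : R, [/\ 1 < lambda, 0 < C &
    (fun n => (num_avoid (@letter_inv V) letter_comm finset.setT finset.set0 n)%:R
       / lambda ^+ n) @ \oo --> C].
Proof.
move=> V2.
have [v [x [p [dp vx vp cov]]]] := walk_around_vertex noncommuting_sym conn V2.
have cirr : irreflexive letter_comm by move=> a; exact: e_irr.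
have csym : symmetric letter_comm by move=> a b; exact: e_sym.
pose lift s := map (fun y : V => (y, s : bool)).
have path_lift s : path (linked (@letter_inv V) letter_comm) (x, s) (lift s p).
  elim: p x dp {vx vp cov} => //= y p IH x /andP[/andP[_ xy] /IH ->].
  by rewrite andbT /linked /letter_comm /= xy /letter_inv /= xpair_eqE negb_and;
    case: (s); rewrite orbT.
have other s (y : letter V) : y \in lift s (x :: p) ->
    (y != (v, true)) && (y != letter_inv (v, true)).
  case/mapP => z zp ->; have zv : z != v by apply: contraNneq vp => <-.
  by rewrite !xpair_eqE (negPf zv).
have cov_lift s (a : letter V) : (a != (v, true)) && (a != letter_inv (v, true)) ->
    has (fun z => ~~ letter_comm a z) ((x, s) :: lift s p).
  case: a => y s' /andP[n1 n2]; apply/hasP.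
  exists (y, s); last by rewrite /letter_comm e_irr.
  rewrite -[_ :: _]/(lift s (x :: p)) map_f // cov //; apply: contraTneq n1 => yv.
  by move: n2; rewrite yv negbK !xpair_eqE !eqxx; case: s'.
have vx0 : ~~ e x v by rewrite e_sym; case/andP: vx.
have last_lift s : last (x, s) (lift s p) = (last x p, s) by rewrite last_map.
apply: (@trace_growth _ _ _ cirr csym (@letter_invK V) _ R (v, true) (x, true) (x, false)
  (x, true) (lift true p) (lift false p)) => //.
- exact/allP/(other true).
- exact/allP/(other false).
- exact: cov_lift.
- exact: cov_lift.
- by rewrite !last_lift xpair_eqE eqxx.
- by rewrite !last_lift /letter_comm e_irr.
- exact/(other true)/mem_head.
- by rewrite /linked /letter_comm /= e_irr /letter_inv /= xpair_eqE andbF.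
Qed.

(** The second walk makes one more step, back to the vertex before the last.  A third vertex
    ensures that there is such a step. *)
Lemma racg_growth : (forall x y : V, exists z, (z != x) && (z != y)) ->
  (exists x y : V, x != y) ->
  exists lambda C : R, [/\ 1 < lambda, 0 < C &
    (fun n => (num_avoid id e finset.setT finset.set0 n)%:R / lambda ^+ n) @ \oo --> C].
Proof.
move=> V3 V2.
have [v [x [p [dp vx vp cov]]]] := walk_around_vertex noncommuting_sym conn V2.
have idK : involutive (@id V) by [].
have linkE y z : noncommuting y z -> linked id e y z.
  by rewrite /linked eq_sym andbC.
have notv z : z \in x :: p -> z != v by apply: contraTneq => ->.
have vx0 : ~~ e x v by rewrite e_sym; case/andP: vx.
case: p => [|b p] in dp vp cov notv *.
  have [z /andP[zx zv]] := V3 x v.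
  by have := cov z zv; rewrite inE (negPf zx).
have pathE : path (linked id e) x (b :: p) by apply: sub_path dp.
have [y yp ly] : exists2 y, y \in x :: b :: p & noncommuting (last x (b :: p)) y.
  have ql : noncommuting (last x (belast b p)) (last x (b :: p)).
    by move: dp; rewrite [b :: p]lastI rcons_path last_rcons => /andP[].
  exists (last x (belast b p)); last by rewrite noncommuting_sym.
  rewrite inE; have := mem_last x (belast b p).
  by rewrite inE => /orP[->//|/mem_belast ->]; rewrite orbT.
have other z : z != v -> (z != v) && (z != id v) by rewrite andbb.
have covers q z : (z != v) && (z != id v) ->
    has (fun z' => ~~ e z z') ((x :: b :: p) ++ q).
  case/andP => zv _; rewrite has_cat; apply/orP; left; apply/hasP; exists z.
    exact: cov.
  by rewrite e_irr.
have lastE : last x (rcons (b :: p) y) = y by rewrite last_rcons.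
case/andP: (ly) => ny ely.
apply: (@trace_growth _ _ _ e_irr e_sym idK _ R v x x b (b :: p) (rcons (b :: p) y)) => //.
- by rewrite rcons_path pathE linkE.
- by apply/allP => z /notv /other.
- apply/allP => z; rewrite -rcons_cons mem_rcons inE => /predU1P[->|/notv/other//].
  exact/other/notv.
- by move=> z /(covers [::]); rewrite cats0.
- by move=> z /(covers [:: y]); rewrite cats1.
- by rewrite lastE.
- by rewrite lastE.
- by apply/other/notv; rewrite !inE eqxx orbT.
- by apply: linkE; case/andP: dp.
Qed.

End Growth.
End ArtinCoxeter.

Theorem theorem2p2 (R : realType) (V : finType) (e : rel V)
  (e_sym : symmetric e) (e_irr : irreflexive e)
  (rels : set (word V))
  (G_raag_or_racg : rels = raag_relators e \/ rels = racg_relators e)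
  (G_not_vcyclic : ~ virtually_cyclic (presented rels))
  (G_not_product : ~ splits_as_product (presented rels)) :
  exists lambda C : R, [/\ 1 < lambda, 0 < C &
    (fun n : nat =>
       (#|` fset_set (sphere (std_gens rels) n)|)%fset%:R / lambda ^+ n) @ \oo --> C].
Proof.
have conn : forall x y, connect (noncommuting e) x y.
  apply: noncommuting_connected G_not_product => //.
    by case: G_raag_or_racg => -> x y xy; [|left]; exists x, y.
  case: G_raag_or_racg => -> r.
    by case=> x [y [_ ->]]; left; exists x, y.
  by case=> [[x [y [_ ->]]]|[x ->]]; [left; exists x, y | right; exists x].
have V2 : exists x y : V, x != y.
  apply/not_existsP => V1; apply: G_not_vcyclic; apply: virtually_cyclic_le1 => x y.
  by apply/eqP/negPn/negP => xy; apply: (V1 x); exists y.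
case: G_raag_or_racg => relsE; subst rels.
  have [l [C [l1 C0 lim]]] := raag_growth e_sym e_irr R conn V2.
  exists l, C; split=> //; rewrite (_ : (fun n => _) = fun n =>
    (num_avoid (@letter_inv V) (fun a b => e a.1 b.1) finset.setT finset.set0 n)%:R
      / l ^+ n) //.
  by apply/funext => n; rewrite card_sphere_raag.
have [l [C [l1 C0 lim]]] : exists lambda C : R, [/\ 1 < lambda, 0 < C &
    (fun n => (num_avoid id e finset.setT finset.set0 n)%:R / lambda ^+ n) @ \oo --> C].
  apply: racg_growth => // x y; apply/not_existsP => V3; apply: G_not_vcyclic.
  apply: (@virtually_cyclic_dihedral _ _ x y) => z.
    have /negP := V3 z; rewrite negb_and !negbK => /orP[]/eqP; by [left|right].
  apply: etrans (pres_mulE _ [:: (z, true)] [:: (z, true)]) _.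
  by apply/pres_classP/pres_eq_rel; right; exists z.
exists l, C; split=> //; rewrite (_ : (fun n => _) = fun n =>
    (num_avoid id e finset.setT finset.set0 n)%:R / l ^+ n) //.
by apply/funext => n; rewrite card_sphere_racg.
Qed.
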